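(* Let $(C,w^C_\bullet)$ and $(D,w^D_\bullet)$ be even $A_\infty$-coalgebras. Then any commuting $(C,D)$-space $(N,w^L_\bullet,w^R_\bullet)$ that is even (i.e. both its left $C$-comodule and right $D$-comodule structures are even) leads to an adjunction of functors, i.e. natural isomorphisms $$\mathbf M^D(M\boxtimes_CN,Q)\cong\mathbf M_{[C,-]}(M,[N,Q]^D)$$ for $M\in\mathbf M_{[C,-]}$ and $Q\in\mathbf M^D$.
   Context: $K$ is a field; $Vect^{\mathbb Z}$ is the category of graded $K$-vector spaces, closed symmetric monoidal with internal hom $[W',W]_p=\prod_{k\in\mathbb Z}Vect(W'_k,W_{k+p})$. Koszul sign conventions apply. $A_\infty$-coalgebra: graded space $C$ with $w_k:C\to C^{\otimes k}$ of degree $2-k$ ($k\ge1$), $\sum_{p+q+r=n}(-1)^{pq+r}(1^{\otimes p}\otimes w_q\otimes1^{\otimes r})w_{p+1+r}=0$ for $n\ge1$ ($p,r\geq 0$, $q\geq 1$), with $\prod_kw_k:C\to\prod_kC^{\otimes k}$ factoring through $\bigoplus_kC^{\otimes k}$. It is even if $w_k=0$ for $k$ odd. Left $A_\infty$-comodule: graded space $P$ with $w^P_k:P\to C^{\otimes k-1}\otimes P$ of degree $2-k$, $\sum_{p+q+r=n,\,q,r\ge1}(-1)^{pq+r}(1^{\otimes p}\otimes w_q\otimes1^{\otimes r-1}\otimes1_P)w^P_{p+1+r}+\sum_{a+b=n,\,b\ge1}(-1)^{ab}(1^{\otimes a}\otimes w^P_b)w^P_{a+1}=0$ for $n\ge1$.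 Right $A_\infty$-comodule over $D$: $w^P_k:P\to P\otimes D^{\otimes k-1}$ of degree $2-k$ with $\sum_{p+q+r=n,\,p,q\ge1}(-1)^{pq+r}(1_P\otimes1^{\otimes p-1}\otimes w_q\otimes1^{\otimes r})w^P_{p+1+r}+\sum_{b+c=n,\,b\ge1}(-1)^c(w^P_b\otimes1^{\otimes c})w^P_{c+1}=0$ for $n\geq 1$. A comodule is even if $w_k^P=0$ for $k$ odd. Morphisms in $\mathbf M^D$ are degree-preserving maps compatible with all structure maps. $A_\infty$-contramodule over $C$: let $w'_k$ have components $w'_k(\bar n)=(-1)^{k(\Sigma\bar n+1)}w_k(\bar n)$, where $w_k(\bar n):C_{-\Sigma\bar n-(2-k)}\to C_{-n_1}\otimes\dots\otimes C_{-n_k}$ is the component of $w_k$. A contramodule is a graded space $M$ with maps $t^M_k:[C^{\otimes k-1},M]\to M$ of degree $2-k$ ($k\ge1$) such that for each $n\ge1$, $\sum_{p+q+r=n,\,p\ge0,\,q,r\ge1}(-1)^{p+qr}t^M_{p+1+r}\circ[C^{\otimes p}\otimes w'_q\otimes C^{\otimes r-1},M]+\sum_{a+b=n,\,a\ge0,\,b\ge1}(-1)^at^M_{a+1}\circ[C^{\otimes a},t^M_b]=0$, where $[C^{\otimes a},[C^{\otimes b-1},M]]\cong[C^{\otimes a+b-1},M]$ is the isomorphism corresponding to right contramodules, identifying $F$ with $x\mapsto(y\mapsto F(x\otimes y))$. Morphisms $h:M\to M'$ in $\mathbf M_{[C,-]}$ are degree-preserving maps with $h\circ t^M_k=t^{M'}_k\circ[C^{\otimes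 k-1},h]$. A $(C,D)$-space $(N,w^L_\bullet,w^R_\bullet)$ is a graded space $N$ with a left $C$-comodule structure $w^L_k:N\to C^{\otimes k-1}\otimes N$ and a right $D$-comodule structure $w^R_l:N\to N\otimes D^{\otimes l-1}$. It is commuting if $(w^L_k\otimes D^{\otimes l-1})\circ w^R_l=(C^{\otimes k-1}\otimes w^R_l)\circ w^L_k$ for all $k,l\ge1$. Contratensor product: for $(M,t^M_\bullet)\in\mathbf M_{[C,-]}$, $M\boxtimes_CN$ is the coequalizer of the two maps $\bigoplus_{k\ge1}[C^{\otimes k-1},M]\otimes N\rightrightarrows M\otimes N$ given on the $k$-th summand by $(ev\otimes N)\circ([C^{\otimes k-1},M]\otimes w^L_k)$ and $t^M_k\otimes N$, where $ev:[C^{\otimes k-1},M]\otimes C^{\otimes k-1}\to M$ is evaluation. Its right $D$-comodule structure is induced by the maps $M\otimes w^R_l$. This gives the functor $-\boxtimes_CN:\mathbf M_{[C,-]}\to\mathbf M^D$. The functor $[N,-]^D:\mathbf M^D\to\mathbf M_{[C,-]}$: for $Q,Q'\in\mathbf M^D$, $[Q,Q']^D_p:=\mathbf M^D(Q[-p],Q')$, i.e. the degree-$p$ elements of $[Q,Q']$ compatible with the $D$-coactions. The contramodule structure on $[N,Q]^D$ is $t_k:[C^{\otimes k-1},[N,Q]^D]\cong[C^{\otimes k-1}\otimes N,Q]^D\xrightarrow{[w^L_k,Q]^D}[N,Q]^D$, where the isomorphism sends $f$ to $\tilde c\otimes n\mapsto f(\tilde c)(n)$ and $C^{\otimes k-1}\otimes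 N$ is a right $D$-comodule via $C^{\otimes k-1}\otimes w^R_\bullet$. *)

(* Defs.v *)
From HB Require Import structures.
From mathcomp Require Import all_boot all_order all_algebra.
From mathcomp Require Import boolp classical_sets functions.

Set Implicit Arguments.
Unset Strict Implicit.
Unset Printing Implicit Defensive.

Import GRing.Theory.
Local Open Scope ring_scope.
Local Open Scope quotient_scope.

Definition mklin (K : fieldType) (U V : lmodType K) (f : U -> V)
    (f_lin : linear f) : {linear U -> V} :=
  HB.pack f (GRing.isLinear.Build K U V *:%R f f_lin).

Record smod (K : fieldType) (V : lmodType K) := SMod {
  smem :> V -> Prop;
  smem0 : smem 0;
  smemL : forall a x y, smem x -> smem y -> smem (a *: x + y) }.

Section SmodTheory.
Variables (K : fieldType) (V : lmodType K) (S : smod V).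

Lemma smemD x y : S x -> S y -> S (x + y).
Proof. by move=> Sx Sy; rewrite -[x]scale1r; apply: smemL. Qed.

Lemma smemZ a x : S x -> S (a *: x).
Proof. by move=> Sx; rewrite -[_ *: _]addr0; apply: smemL => //; apply: smem0. Qed.

Lemma smemN x : S x -> S (- x).
Proof. by move=> Sx; rewrite -scaleN1r; apply: smemZ. Qed.

Definition smemb : pred V := fun x => `[< S x >].

Record lsub := LSub { lval :> V; lvalP : smemb lval }.

HB.instance Definition _ := [isSub for lval].
HB.instance Definition _ := [Choice of lsub by <:].

Fact smemb_submod : subsemimod_closed smemb.
Proof.
apply: GRing.submod_closed_semi; split; first by apply/asboolP/smem0.
by move=> a x y /asboolP Sx /asboolP Sy; apply/asboolP/smemL.
Qed.

HB.instance Definition _ :=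
  GRing.SubChoice_isSubLmodule.Build K V smemb lsub smemb_submod.

Lemma lval_lin : linear lval.
Proof. by []. Qed.

Definition lincl : {linear lsub -> V} := mklin lval_lin.

Lemma lvalS (x : lsub) : S (lval x).
Proof. exact/asboolP/lvalP. Qed.

Definition mklsub (x : V) (Sx : S x) : lsub := LSub (introT (asboolP _) Sx).

Definition leqv (x y : V) : bool := `[< S (x - y) >].

Fact leqv_equiv : equiv_class_of leqv.
Proof.
split=> [x|x y|y x z]; rewrite /leqv.
- by apply/asboolP; rewrite subrr; apply: smem0.
- by apply/asboolP/asboolP => /smemN; rewrite opprB.
move=> /asboolP Sxy /asboolP Syz; apply/asboolP.
by rewrite -[x](subrK y) -addrA; apply: smemD.
Qed.

Canonical leqv_equivrel := EquivRelPack leqv_equiv.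

Definition lquot := {eq_quot leqv}.
HB.instance Definition _ : EqQuotient V leqv lquot := EqQuotient.on lquot.
HB.instance Definition _ := Choice.on lquot.

Lemma lquotP (x y : V) : reflect (S (x - y)) (x == y %[mod lquot]).
Proof. by apply: (iffP eqP) => [/eqP|H]; [rewrite eqmodE => /asboolP
  |apply/eqP; rewrite eqmodE; apply/asboolP]. Qed.

Lemma lquot_eq (x y : V) : S (x - y) -> \pi_lquot x = \pi_lquot y.
Proof. by move/lquotP/eqP. Qed.

Lemma lquot_repr (x : V) : S (repr (\pi_lquot x) - x).
Proof. by apply/lquotP; rewrite reprK. Qed.

Definition lquot_add (x y : lquot) : lquot := \pi_lquot (repr x + repr y).
Definition lquot_opp (x : lquot) : lquot := \pi_lquot (- repr x).
Definition lquot_scale (a : K) (x : lquot) : lquot := \pi_lquot (a *: repr x).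

Fact lquot_addE (x y : V) :
  lquot_add (\pi_lquot x) (\pi_lquot y) = \pi_lquot (x + y).
Proof.
by apply: lquot_eq; rewrite opprD addrACA; apply: smemD; apply: lquot_repr.
Qed.

Fact lquot_oppE (x : V) : lquot_opp (\pi_lquot x) = \pi_lquot (- x).
Proof. by apply: lquot_eq; rewrite -opprD; apply/smemN/lquot_repr. Qed.

Fact lquot_scaleE a (x : V) : lquot_scale a (\pi_lquot x) = \pi_lquot (a *: x).
Proof. by apply: lquot_eq; rewrite -scalerBr; apply/smemZ/lquot_repr. Qed.

Lemma lquotW (P : lquot -> Prop) :
  (forall x, P (\pi_lquot x)) -> forall z, P z.
Proof. exact: quotW. Qed.

Fact lquot_addA : associative lquot_add.
Proof.
by elim/lquotW=> x; elim/lquotW=> y; elim/lquotW=> z; rewrite !lquot_addE addrA.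
Qed.
Fact lquot_addC : commutative lquot_add.
Proof. by elim/lquotW=> x; elim/lquotW=> y; rewrite !lquot_addE addrC. Qed.
Fact lquot_add0 : left_id (\pi_lquot 0) lquot_add.
Proof. by elim/lquotW=> x; rewrite lquot_addE add0r. Qed.
Fact lquot_addN : left_inverse (\pi_lquot 0) lquot_opp lquot_add.
Proof. by elim/lquotW=> x; rewrite lquot_oppE lquot_addE addNr. Qed.

HB.instance Definition _ :=
  GRing.isZmodule.Build lquot lquot_addA lquot_addC lquot_add0 lquot_addN.

Fact lquot_scaleA a b x :
  lquot_scale a (lquot_scale b x) = lquot_scale (a * b) x.
Proof. by elim/lquotW: x => x; rewrite !lquot_scaleE scalerA. Qed.
Fact lquot_scale1 : left_id 1 lquot_scale.
Proof. by elim/lquotW=> x; rewrite lquot_scaleE scale1r. Qed.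
Fact lquot_scaleDr : right_distributive lquot_scale +%R.
Proof.
move=> a; elim/lquotW=> x; elim/lquotW=> y.
by rewrite /GRing.add /= !(lquot_addE, lquot_scaleE) scalerDr.
Qed.
Fact lquot_scaleDl x : {morph lquot_scale^~ x : a b / a + b}.
Proof.
move=> a b; elim/lquotW: x => x.
by rewrite {2}/GRing.add /= !lquot_scaleE lquot_addE scalerDl.
Qed.

HB.instance Definition _ := GRing.Zmodule_isLmodule.Build K lquot
  lquot_scaleA lquot_scale1 lquot_scaleDr lquot_scaleDl.

Lemma lpi_lin : linear (\pi_lquot : V -> lquot).
Proof.
by move=> a x y; rewrite /GRing.add /GRing.scale /= !(lquot_scaleE, lquot_addE).
Qed.

Definition lpi : {linear V -> lquot} := mklin lpi_lin.

Lemma lpi_surj (z : lquot) : exists x, z = lpi x.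
Proof. by exists (repr z); rewrite /= reprK. Qed.

Lemma lpi0P x : lpi x = 0 <-> S x.
Proof.
split=> [|Sx].
  by rewrite -(linear0 lpi) /= => /eqP/lquotP; rewrite subr0.
by rewrite -(linear0 lpi) /=; apply: lquot_eq; rewrite subr0.
Qed.

Fact lquot_map_lin (U : lmodType K) (f : {linear V -> U}) :
  (forall x, S x -> f x = 0) -> linear (fun z : lquot => f (repr z)).
Proof.
move=> f0; have fr x : f (repr (lpi x)) = f x.
  by apply/eqP; rewrite -subr_eq0 -raddfB; apply/eqP/f0/lquot_repr.
move=> a z t; have [x ->] := lpi_surj z; have [y ->] := lpi_surj t.
by rewrite -linearP !fr linearP.
Qed.

Definition lquot_map (U : lmodType K) (f : {linear V -> U})
    (f0 : forall x, S x -> f x = 0) : {linear lquot -> U} :=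
  mklin (lquot_map_lin f0).

Lemma lquot_mapE (U : lmodType K) (f : {linear V -> U})
    (f0 : forall x, S x -> f x = 0) x : lquot_map f0 (lpi x) = f x.
Proof.
by apply/eqP; rewrite /= -subr_eq0 -raddfB; apply/eqP/f0/lquot_repr.
Qed.

End SmodTheory.

Definition bilin (K : fieldType) (V W U : lmodType K) (b : V -> W -> U) :=
  (forall w, linear (b^~ w)) /\ (forall v, linear (b v)).

Section Tensor.
Variables (K : fieldType) (V W : lmodType K).
Implicit Types (s t : seq (V * W)).

Definition tsum (U : lmodType K) (b : V -> W -> U) s : U :=
  \sum_(x <- s) b x.1 x.2.

(* A sequence [:: (v1, w1); ...; (vn, wn)] stands for v1 ⊗ w1 + ... + vn ⊗ wn.
   Two such formal sums are identified when no bilinear map separates them;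
   [tlift], [tliftE] and [tens_ext] give the universal property. *)
Definition teqv s t : bool :=
  `[< forall (U : lmodType K) (b : V -> W -> U), bilin b ->
      tsum b s = tsum b t >].

Fact teqv_equiv : equiv_class_of teqv.
Proof.
split=> [s|s t|t s u]; rewrite /teqv.
- exact/asboolP.
- by apply/asboolP/asboolP => H U b hb; rewrite H.
- by move=> /asboolP st /asboolP tu; apply/asboolP => U b hb; rewrite st ?tu.
Qed.

Canonical teqv_equivrel := EquivRelPack teqv_equiv.

Definition tens := {eq_quot teqv}.
HB.instance Definition _ : EqQuotient (seq (V * W)) teqv tens :=
  EqQuotient.on tens.
HB.instance Definition _ := Choice.on tens.

Lemma tensW (P : tens -> Prop) :
  (forall s, P (\pi_tens s)) -> forall z, P z.
Proof. exact: quotW. Qed.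

Lemma tens_eqP s t : \pi_tens s = \pi_tens t <->
  forall (U : lmodType K) (b : V -> W -> U), bilin b -> tsum b s = tsum b t.
Proof.
split=> [/eqP|H]; first by rewrite eqmodE => /asboolP.
by apply/eqP; rewrite eqmodE; apply/asboolP.
Qed.

Lemma tsum_repr (U : lmodType K) (b : V -> W -> U) s :
  bilin b -> tsum b (repr (\pi_tens s)) = tsum b s.
Proof. by move=> hb; apply: (tens_eqP _ _).1 => //; rewrite reprK. Qed.

Lemma tsum_cat (U : lmodType K) (b : V -> W -> U) s t :
  tsum b (s ++ t) = tsum b s + tsum b t.
Proof. exact: big_cat. Qed.

Definition fscale (a : K) s := [seq (a *: x.1, x.2) | x <- s].

Lemma tsum_scale (U : lmodType K) (b : V -> W -> U) a s :
  bilin b -> tsum b (fscale a s) = a *: tsum b s.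
Proof.
case=> bl _; rewrite /tsum big_map scaler_sumr; apply: eq_bigr => x _ /=.
exact: (linearZ_LR (mklin (bl x.2))).
Qed.

Definition tens_add (x y : tens) : tens := \pi_tens (repr x ++ repr y).
Definition tens_scale (a : K) (x : tens) : tens := \pi_tens (fscale a (repr x)).
Definition tens_opp (x : tens) : tens := tens_scale (-1) x.

Fact tens_addE s t : tens_add (\pi_tens s) (\pi_tens t) = \pi_tens (s ++ t).
Proof. by apply/tens_eqP => U b hb; rewrite !tsum_cat !tsum_repr. Qed.

Fact tens_scaleE a s : tens_scale a (\pi_tens s) = \pi_tens (fscale a s).
Proof. by apply/tens_eqP => U b hb; rewrite !tsum_scale ?tsum_repr. Qed.

Fact tens_addA : associative tens_add.
Proof.
by elim/tensW=> x; elim/tensW=> y; elim/tensW=> z; rewrite !tens_addE catA.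
Qed.
Fact tens_addC : commutative tens_add.
Proof.
elim/tensW=> x; elim/tensW=> y; rewrite !tens_addE; apply/tens_eqP => U b _.
by rewrite !tsum_cat addrC.
Qed.
Fact tens_add0 : left_id (\pi_tens [::]) tens_add.
Proof. by elim/tensW=> x; rewrite tens_addE. Qed.
Fact tens_addN : left_inverse (\pi_tens [::]) tens_opp tens_add.
Proof.
elim/tensW=> x; rewrite /tens_opp tens_scaleE tens_addE.
apply/tens_eqP => U b hb.
by rewrite tsum_cat tsum_scale // scaleN1r addNr /tsum big_nil.
Qed.

HB.instance Definition _ :=
  GRing.isZmodule.Build tens tens_addA tens_addC tens_add0 tens_addN.

Fact tens_scaleA a b x : tens_scale a (tens_scale b x) = tens_scale (a * b) x.
Proof.
elim/tensW: x => x; rewrite !tens_scaleE; apply/tens_eqP => U c hc.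
by rewrite !tsum_scale // scalerA.
Qed.
Fact tens_scale1 : left_id 1 tens_scale.
Proof.
elim/tensW=> x; rewrite tens_scaleE; apply/tens_eqP => U c hc.
by rewrite !tsum_scale // scale1r.
Qed.
Fact tens_scaleDr : right_distributive tens_scale +%R.
Proof.
move=> a; elim/tensW=> x; elim/tensW=> y.
rewrite /GRing.add /= !(tens_addE, tens_scaleE); apply/tens_eqP => U c hc.
by rewrite !(tsum_scale, tsum_cat) // scalerDr.
Qed.
Fact tens_scaleDl x : {morph tens_scale^~ x : a b / a + b}.
Proof.
move=> a b; elim/tensW: x => x.
rewrite {2}/GRing.add /= !tens_scaleE tens_addE; apply/tens_eqP => U c hc.
by rewrite !(tsum_scale, tsum_cat) // scalerDl.
Qed.

HB.instance Definition _ := GRing.Zmodule_isLmodule.Build K tens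
  tens_scaleA tens_scale1 tens_scaleDr tens_scaleDl.

Lemma tens_piD s t : \pi_tens s + \pi_tens t = \pi_tens (s ++ t).
Proof. exact: tens_addE. Qed.

Lemma tens_piZ a s : a *: \pi_tens s = \pi_tens (fscale a s).
Proof. exact: tens_scaleE. Qed.

Definition tpure (v : V) (w : W) : tens := \pi_tens [:: (v, w)].

Lemma tpure_bilin : bilin tpure.
Proof.
split=> [w a x y|v a x y]; rewrite /tpure tens_piZ tens_piD;
  apply/tens_eqP => U b hb; rewrite !(tsum_cat, tsum_scale) // /tsum !big_seq1 /=.
  exact: (hb.1 w).
exact: (hb.2 v).
Qed.

Lemma tens_sum (z : tens) :
  exists s : seq (V * W), z = \sum_(x <- s) tpure x.1 x.2.
Proof.
elim/tensW: z => s; exists s; elim: s => [|[v w] s IH].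
  by rewrite big_nil.
by rewrite big_cons -IH tens_piD.
Qed.

Lemma tens_ext (U : lmodType K) (f g : {linear tens -> U}) :
  (forall v w, f (tpure v w) = g (tpure v w)) -> f =1 g.
Proof.
move=> fg z; have [s ->] := tens_sum z; rewrite !linear_sum.
by apply: eq_bigr => x _.
Qed.

Fact tlift_lin (U : lmodType K) (b : V -> W -> U) :
  bilin b -> linear (fun z : tens => tsum b (repr z)).
Proof.
move=> hb a; elim/tensW=> x; elim/tensW=> y.
by rewrite tens_piZ tens_piD !tsum_repr // tsum_cat tsum_scale.
Qed.

Definition tlift (U : lmodType K) (b : V -> W -> U) (hb : bilin b) :
  {linear tens -> U} := mklin (tlift_lin hb).

Lemma tliftE (U : lmodType K) (b : V -> W -> U) (hb : bilin b) v w :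
  tlift hb (tpure v w) = b v w.
Proof. by rewrite /= tsum_repr // /tsum big_seq1. Qed.

End Tensor.

(* A graded space is given by its total space, the direct sum of its
   homogeneous components, with the projections [gproj i] onto the latter. *)
Record gvect (K : fieldType) := GVect {
  gsort :> lmodType K;
  gproj : int -> {linear gsort -> gsort};
  gproj_proj : forall i j x,
    gproj i (gproj j x) = if i == j then gproj j x else 0;
  gproj_sum : forall x,
    exists s : seq int, uniq s /\ x = \sum_(i <- s) gproj i x }.

Definition gdeg (K : fieldType) (V : gvect K) (i : int) (x : V) : Prop :=
  gproj V i x = x.

Definition gmap_deg (K : fieldType) (V W : gvect K) (d : int) (f : V -> W) :=
  forall i x, gdeg i x -> gdeg (i + d) (f x).

Section Builder.
Variables (K : fieldType) (V : lmodType K) (P : int -> {linear V -> V}).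
Variable (G : int -> V -> Prop).
Hypothesis PG : forall i j x, G i x -> P j x = if j == i then x else 0.
Hypothesis Ggen : forall x,
  exists n (i : 'I_n -> int) (y : 'I_n -> V),
    (forall k, G (i k) (y k)) /\ x = \sum_k y k.

Fact builder_proj i j x : P i (P j x) = if i == j then P j x else 0.
Proof.
have [n [d [y [Gy ->]]]] := Ggen x.
case: (i =P j) => [<-|ij]; rewrite !linear_sum.
  apply: eq_bigr => k _; rewrite (PG i (Gy k)); case: eqP => [ik|_].
    by rewrite (PG i (Gy k)) ik eqxx.
  by rewrite linear0.
apply: big1 => k _; rewrite (PG j (Gy k)); case: eqP => [jk|_].
  by rewrite (PG i (Gy k)); case: eqP => // ik; rewrite ik jk in ij.
by rewrite linear0.
Qed.

Fact builder_sum x : exists s : seq int, uniq s /\ x = \sum_(i <- s) P i x.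
Proof.
have [n [d [y [Gy ->]]]] := Ggen x.
exists (undup [seq d k | k <- enum 'I_n]); split; first exact: undup_uniq.
under [RHS]eq_bigr do rewrite linear_sum.
rewrite exchange_big /=; apply: eq_bigr => k _.
under eq_bigr do rewrite (PG _ (Gy k)).
rewrite (bigD1_seq (d k)) ?undup_uniq//=.
  by rewrite eqxx big1 ?addr0// => i /negPf ->.
by rewrite mem_undup map_f// mem_enum.
Qed.

Definition mkgvect : gvect K := GVect builder_proj builder_sum.

Lemma mkgvect_deg i x : G i x -> gdeg (V := mkgvect) i x.
Proof. by move=> Gx; rewrite /gdeg /= (PG i Gx) eqxx. Qed.

End Builder.

Section GradedTheory.
Variables (K : fieldType) (V : gvect K).

Lemma gdegD i (x y : V) : gdeg i x -> gdeg i y -> gdeg i (x + y).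
Proof. by rewrite /gdeg linearD => -> ->. Qed.

Lemma gdegZ i a (x : V) : gdeg i x -> gdeg i (a *: x).
Proof. by rewrite /gdeg linearZ => ->. Qed.

Lemma gdeg0 i : gdeg i (0 : V).
Proof. exact: linear0. Qed.

Lemma gdeg_sum i (I : Type) (r : seq I) (F : I -> V) :
  (forall k, gdeg i (F k)) -> gdeg i (\sum_(k <- r) F k).
Proof.
by move=> SF; elim/big_rec: _ => [|k x _]; [apply: gdeg0|apply: gdegD].
Qed.

Lemma gdeg_proj i (x : V) : gdeg i (gproj V i x).
Proof. by rewrite /gdeg gproj_proj eqxx. Qed.

Lemma gproj_deg i j (x : V) :
  gdeg i x -> gproj V j x = if j == i then x else 0.
Proof. by move=> xi; rewrite -{1}xi gproj_proj xi. Qed.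

Definition gsupp (x : V) : seq int := projT1 (cid (gproj_sum x)).

Lemma gsupp_uniq x : uniq (gsupp x).
Proof. by rewrite /gsupp; case: cid => s /= []. Qed.

Lemma gsupp_sum x : x = \sum_(i <- gsupp x) gproj V i x.
Proof. by rewrite /gsupp; case: cid => s /= []. Qed.

Lemma gproj_nsupp i x : i \notin gsupp x -> gproj V i x = 0.
Proof.
move=> ix; rewrite {1}(gsupp_sum x) linear_sum big_seq big1// => j jx.
by rewrite gproj_proj; case: eqP => // ij; rewrite ij jx in ix.
Qed.

Lemma gdeg_ind (P : V -> Prop) :
  P 0 -> (forall x y, P x -> P y -> P (x + y)) ->
  (forall i x, gdeg i x -> P x) -> forall x, P x.
Proof.
move=> P0 PD Pdeg x; rewrite (gsupp_sum x).
by elim/big_rec: _ => // i y _ Py; apply: PD => //; apply: Pdeg (gdeg_proj i x).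
Qed.

Lemma glin_ext (U : lmodType K) (f g : {linear V -> U}) :
  (forall i x, gdeg i x -> f x = g x) -> f =1 g.
Proof.
move=> fg; elim/gdeg_ind => [|x y fx fy|//]; first by rewrite !linear0.
by rewrite !linearD fx fy.
Qed.

Section Glue.
Variables (U : lmodType K) (F : int -> {linear V -> U}).

Fact glue_widen (s : seq int) x : uniq s -> {subset gsupp x <= s} ->
  \sum_(i <- gsupp x) F i (gproj V i x) = \sum_(i <- s) F i (gproj V i x).
Proof.
move=> us xs; rewrite [RHS](bigID (mem (gsupp x))) /= [X in _ + X]big1 ?addr0.
  rewrite -[RHS]big_filter; apply: perm_big; apply: uniq_perm.
  - exact: gsupp_uniq.
  - exact: filter_uniq.
  by move=> i; rewrite mem_filter; apply/idP/andP => [ix|[]//]; rewrite ix xs.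
by move=> i ix; rewrite gproj_nsupp// linear0.
Qed.

Fact glue_lin : linear (fun x => \sum_(i <- gsupp x) F i (gproj V i x)).
Proof.
move=> a x y.
pose s := undup (gsupp x ++ gsupp y ++ gsupp (a *: x + y)).
have us : uniq s by apply: undup_uniq.
rewrite !(@glue_widen s) //; try by move=> i; rewrite mem_undup !mem_cat => ->; rewrite ?orbT.
rewrite scaler_sumr -big_split; apply: eq_bigr => i _.
by rewrite !linearP.
Qed.

Definition glue : {linear V -> U} := mklin glue_lin.

Lemma glueE i x : gdeg i x -> glue x = F i x.
Proof.
move=> xi; have us : uniq (undup (i :: gsupp x)) by apply: undup_uniq.
rewrite /= (@glue_widen (undup (i :: gsupp x)))//; last first.
  by move=> j jx; rewrite mem_undup inE jx orbT.
rewrite (bigD1_seq i) ?mem_undup ?mem_head//= xi big1 ?addr0// => j ji.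
by rewrite (gproj_deg j xi) (negPf ji) linear0.
Qed.

End Glue.

(* x |-> (-1)^(d|x|) x: the sign produced when a map of degree d moves past x *)
Definition ksign (d : int) : {linear V -> V} :=
  glue (fun i => ((-1 : K) ^ (d * i)) \*: idfun).

Lemma ksignE d i x : gdeg i x -> ksign d x = (-1) ^ (d * i) *: x.
Proof. by move=> xi; rewrite /ksign (glueE _ xi). Qed.

End GradedTheory.

Section GTensor.
Variables (K : fieldType) (V W : gvect K).

Lemma tpure_supp (v : V) (w : W) : tpure v w =
  \sum_(i <- gsupp v) \sum_(j <- gsupp w) tpure (gproj V i v) (gproj W j w).
Proof.
have hb := tpure_bilin V W.
have -> : tpure v w = mklin (hb.1 w) v by [].
rewrite {1}(gsupp_sum v) linear_sum; apply: eq_bigr => i _ /=.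
have -> : tpure (gproj V i v) w = mklin (hb.2 (gproj V i v)) w by [].
by rewrite {1}(gsupp_sum w) linear_sum.
Qed.

Definition gtens_component (n : int) (v : V) (w : W) : tens V W :=
  \sum_(i <- gsupp v) tpure (gproj V i v) (gproj W (n - i) w).

Fact gtens_component_bilin n : bilin (gtens_component n).
Proof.
have hb := tpure_bilin V W; split=> [w|v].
  have Fl i : linear (fun v : V => tpure v (gproj W (n - i) w)) by apply: hb.1.
  exact: (glue_lin (fun i => mklin (Fl i))).
move=> a x y; rewrite /gtens_component scaler_sumr -big_split.
by apply: eq_bigr => i _; rewrite linearP; apply: hb.2.
Qed.

Definition gtens_proj n : {linear tens V W -> tens V W} :=
  tlift (gtens_component_bilin n).

Definition gtens_deg (n : int) (z : tens V W) : Prop :=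
  exists i j v w, [/\ i + j = n, gdeg i v, gdeg j w & z = tpure v w].

Fact gtens_projE i j z :
  gtens_deg i z -> gtens_proj j z = if j == i then z else 0.
Proof.
move=> [p [q [v [w [<- vp wq ->]]]]]; rewrite /gtens_proj tliftE.
have hb := tpure_bilin V W.
have Fl k : linear (fun v : V => tpure v (gproj W (j - k) w)) by apply: hb.1.
rewrite -[LHS]/(glue (fun k => mklin (Fl k)) v) (glueE _ vp) /=.
rewrite (gproj_deg _ wq) subr_eq addrC; case: eqP => // _.
exact: (linear0 (mklin (hb.2 v))).
Qed.

Fact gtens_gen z : exists n (i : 'I_n -> int) (y : 'I_n -> tens V W),
  (forall k, gtens_deg (i k) (y k)) /\ z = \sum_k y k.
Proof.
have [s ->] := tens_sum z.
pose t' := flatten [seq [seq ((i, j), x) | i <- gsupp x.1, j <- gsupp x.2] | x <- s].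
pose d (u : (int * int) * (V * W)) := u.1.1 + u.1.2.
pose y (u : (int * int) * (V * W)) :=
  tpure (gproj V u.1.1 u.2.1) (gproj W u.1.2 u.2.2).
exists (size t'), (fun k => d (tnth (in_tuple t') k)),
  (fun k => y (tnth (in_tuple t') k)); split.
  move=> k; exists (tnth (in_tuple t') k).1.1, (tnth (in_tuple t') k).1.2.
  exists (gproj V (tnth (in_tuple t') k).1.1 (tnth (in_tuple t') k).2.1).
  exists (gproj W (tnth (in_tuple t') k).1.2 (tnth (in_tuple t') k).2.2).
  by split=> //; apply: gdeg_proj.
rewrite -(big_tnth _ _ t' xpredT) big_flatten big_map.
apply: eq_bigr => -[v w] _ /=; rewrite big_allpairs_dep /=.
exact: tpure_supp.
Qed.

Definition gtens : gvect K := mkgvect gtens_projE gtens_gen.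

Definition gpure (v : V) (w : W) : gtens := tpure v w.

Lemma gpure_deg i j v w : gdeg i v -> gdeg j w -> gdeg (i + j) (gpure v w).
Proof. by move=> vi wj; apply: mkgvect_deg; exists i, j, v, w. Qed.

Lemma gtens_ext (U : lmodType K) (f g : {linear gtens -> U}) :
  (forall i j v w, gdeg i v -> gdeg j w -> f (gpure v w) = g (gpure v w)) ->
  f =1 g.
Proof.
move=> fg; apply: tens_ext => v w; rewrite tpure_supp !linear_sum.
apply: eq_bigr => i _; rewrite !linear_sum; apply: eq_bigr => j _ /=.
by apply: fg; apply: gdeg_proj.
Qed.

End GTensor.

Section Lcomp.
Variables (K : fieldType) (U V W : lmodType K).

Fact lcomp_lin (g : {linear V -> W}) (f : {linear U -> V}) :
  linear (fun x => g (f x)).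
Proof. by move=> a x y; rewrite !linearP. Qed.

Definition lcomp g f : {linear U -> W} := mklin (lcomp_lin g f).

Lemma lcompE g f x : lcomp g f x = g (f x).
Proof. by []. Qed.

End Lcomp.

Definition lid (K : fieldType) (V : lmodType K) : {linear V -> V} := idfun.

Section Assoc.
Variables (K : fieldType) (U V W : lmodType K).

Fact tassoc_in_bilin (w : W) :
  bilin (fun (u : U) (v : V) => tpure u (tpure v w)).
Proof.
have hb := tpure_bilin U (tens V W); have hc := tpure_bilin V W.
split=> [v|u] a x y; first by rewrite hb.1.
by rewrite hc.1 hb.2.
Qed.

Fact tassoc_bilin : bilin (fun z w => tlift (tassoc_in_bilin w) z).
Proof.
have hb := tpure_bilin U (tens V W); have hc := tpure_bilin V W.
split=> [w a x y|z a x y]; first by rewrite linearP.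
cbv beta; have [s ->] := tens_sum z.
rewrite 3!(linear_sum (tlift _)) scaler_sumr -big_split.
by apply: eq_bigr => -[u v] _; rewrite !tliftE /= hc.2 hb.2.
Qed.

Definition tassoc : {linear tens (tens U V) W -> tens U (tens V W)} :=
  tlift tassoc_bilin.

Lemma tassocE u v w : tassoc (tpure (tpure u v) w) = tpure u (tpure v w).
Proof. by rewrite /tassoc !tliftE. Qed.

Fact tassocV_in_bilin (u : U) :
  bilin (fun (v : V) (w : W) => tpure (tpure u v) w).
Proof.
have hb := tpure_bilin (tens U V) W; have hc := tpure_bilin U V.
split=> [w|v] a x y; last by rewrite hb.2.
by rewrite hc.2 hb.1.
Qed.

Fact tassocV_bilin : bilin (fun u z => tlift (tassocV_in_bilin u) z).
Proof.
have hb := tpure_bilin (tens U V) W; have hc := tpure_bilin U V.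
split=> [z a x y|u a x y]; last by rewrite linearP.
cbv beta; have [s ->] := tens_sum z.
rewrite 3!(linear_sum (tlift _)) scaler_sumr -big_split.
by apply: eq_bigr => -[v w] _; rewrite !tliftE /= hc.1 hb.1.
Qed.

Definition tassocV : {linear tens U (tens V W) -> tens (tens U V) W} :=
  tlift tassocV_bilin.

Lemma tassocVE u v w : tassocV (tpure u (tpure v w)) = tpure (tpure u v) w.
Proof. by rewrite /tassocV !tliftE. Qed.

Lemma tassocK : cancel tassoc tassocV.
Proof.
move=> z; rewrite -[LHS]/(lcomp tassocV tassoc z) -[RHS]/(lid _ z).
move: z; apply: tens_ext => x w.
have hb := tpure_bilin (tens U V) W.
have [s ->] := tens_sum x.
have -> : tpure (\sum_(i <- s) tpure i.1 i.2) w =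
  \sum_(i <- s) tpure (tpure i.1 i.2) w by exact: (linear_sum (mklin (hb.1 w))).
by rewrite !linear_sum; apply: eq_bigr => i _; rewrite lcompE tassocE tassocVE.
Qed.

Lemma tassocVK : cancel tassocV tassoc.
Proof.
move=> z; rewrite -[LHS]/(lcomp tassoc tassocV z) -[RHS]/(lid _ z).
move: z; apply: tens_ext => u x.
have hb := tpure_bilin U (tens V W).
have [s ->] := tens_sum x.
have -> : tpure u (\sum_(i <- s) tpure i.1 i.2) =
  \sum_(i <- s) tpure u (tpure i.1 i.2) by exact: (linear_sum (mklin (hb.2 u))).
by rewrite !linear_sum; apply: eq_bigr => i _; rewrite lcompE tassocVE tassocE.
Qed.

End Assoc.

Section LUnit.
Variables (K : fieldType) (V : lmodType K).

Fact tlunit_bilin : bilin (fun (a : K^o) (v : V) => a *: v).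
Proof.
split=> [v a x y|b a x y]; first by rewrite scalerDl -scalerA.
by rewrite scalerDr !scalerA mulrC.
Qed.

Definition tlunit : {linear tens K^o V -> V} := tlift tlunit_bilin.

End LUnit.

Section GMap.
Variable K : fieldType.

Definition gunit_proj (j : int) : {linear K^o -> K^o} :=
  if j == 0 then lid K^o else mklin (linearP (\0 : {linear K^o -> K^o})).

Fact gunit_projE (i j : int) (x : K^o) :
  i = 0 -> gunit_proj j x = if j == i then x else 0.
Proof. by move=> ->; rewrite /gunit_proj; case: eqP. Qed.

Fact gunit_gen (x : K^o) : exists n (i : 'I_n -> int) (y : 'I_n -> K^o),
  (forall k, i k = 0) /\ x = \sum_k y k.
Proof. by exists 1%N, (fun _ => 0), (fun _ => x); rewrite big_ord1. Qed.

(* the ground field in degree 0 *)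
Definition gunit : gvect K :=
  mkgvect (G := fun i _ => i = 0) gunit_projE gunit_gen.

Lemma gmap_proj (V W : gvect K) d (f : {linear V -> W}) j x :
  gmap_deg d f -> gproj W j (f x) = f (gproj V (j - d) x).
Proof.
move=> fd; rewrite -[LHS]/(lcomp (gproj W j) f x).
rewrite -[RHS]/(lcomp f (gproj V (j - d)) x).
move: x; apply: glin_ext => i x xi; rewrite !lcompE.
rewrite (gproj_deg _ (fd _ _ xi)) (gproj_deg _ xi) subr_eq.
by case: eqP => // _; rewrite linear0.
Qed.

Lemma lid_deg (V : gvect K) : gmap_deg 0 (lid V).
Proof. by move=> i x; rewrite addr0. Qed.

Lemma lcomp_deg (U V W : gvect K) d e (g : {linear V -> W})
    (f : {linear U -> V}) :
  gmap_deg e g -> gmap_deg d f -> gmap_deg (d + e) (lcomp g f).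
Proof. by move=> ge fd i x xi; rewrite addrA; apply/ge/fd. Qed.

Section KTens.
Variables V V' W W' : gvect K.
Variables (d : int) (f : {linear V -> V'}) (g : {linear W -> W'}).

Fact ktens_bilin :
  bilin (fun v w => gpure (f (ksign V d v)) (g w) : gtens V' W').
Proof.
have hb := tpure_bilin V' W'.
split=> [w|v] a x y; rewrite !linearP; [exact: hb.1|exact: hb.2].
Qed.

(* f ⊗ g for g of degree d: v ⊗ w |-> (-1)^(d|v|) f v ⊗ g w *)
Definition ktens : {linear gtens V W -> gtens V' W'} := tlift ktens_bilin.

Lemma ktensE v w : ktens (gpure v w) = gpure (f (ksign V d v)) (g w).
Proof. exact: tliftE. Qed.

Lemma ktensE_deg i v w :
  gdeg i v -> ktens (gpure v w) = (-1) ^ (d * i) *: gpure (f v) (g w).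
Proof.
move=> vi; rewrite ktensE (ksignE _ vi) linearZ.
exact: (linearZ_LR (mklin ((tpure_bilin V' W').1 (g w)))).
Qed.

End KTens.

Lemma gtens_map_deg (V W U : gvect K) d (f : {linear gtens V W -> U}) :
  (forall i j v w, gdeg i v -> gdeg j w -> gdeg (i + j + d) (f (gpure v w))) ->
  gmap_deg d f.
Proof.
move=> fd n z zn; rewrite /gdeg -{2}zn.
rewrite -[LHS]/(lcomp (gproj U (n + d)) f z).
rewrite -[RHS]/(lcomp f (gproj (gtens V W) n) z).
move: z {zn}; apply: gtens_ext => i j v w vi wj.
rewrite !lcompE (gproj_deg _ (gpure_deg vi wj)).
rewrite (gproj_deg _ (fd _ _ _ _ vi wj)) (inj_eq (addIr d)).
by case: eqP => // _; rewrite linear0.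
Qed.

Lemma ktens_deg (V V' W W' : gvect K) d e (f : {linear V -> V'})
    (g : {linear W -> W'}) :
  gmap_deg d f -> gmap_deg e g -> gmap_deg (d + e) (ktens e f g).
Proof.
move=> fd ge; apply: gtens_map_deg => i j v w vi wj.
rewrite (ktensE_deg _ _ _ _ vi); apply: gdegZ.
by rewrite addrACA; apply: gpure_deg; [apply: fd|apply: ge].
Qed.

Definition gassoc (U V W : gvect K) :
  {linear gtens (gtens U V) W -> gtens U (gtens V W)} := tassoc U V W.

Definition gassocV (U V W : gvect K) :
  {linear gtens U (gtens V W) -> gtens (gtens U V) W} := tassocV U V W.

Definition glunit (V : gvect K) : {linear gtens gunit V -> V} := tlunit V.

Definition gpurel (V W : gvect K) (w : W) : {linear V -> gtens V W} :=
  mklin ((tpure_bilin V W).1 w).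

Definition gpurer (V W : gvect K) (v : V) : {linear W -> gtens V W} :=
  mklin ((tpure_bilin V W).2 v).

Lemma gassocE (U V W : gvect K) (u : U) (v : V) (w : W) :
  gassoc U V W (gpure (gpure u v) w) = gpure u (gpure v w).
Proof. exact: tassocE. Qed.

Lemma gassocVE (U V W : gvect K) (u : U) (v : V) (w : W) :
  gassocV U V W (gpure u (gpure v w)) = gpure (gpure u v) w.
Proof. exact: tassocVE. Qed.

Lemma glunitE (V : gvect K) (a : gunit) (v : V) :
  glunit V (gpure a v) = (a : K) *: v.
Proof. exact: tliftE. Qed.

Lemma gassocV_deg (U V W : gvect K) : gmap_deg 0 (gassocV U V W).
Proof.
apply: gtens_map_deg => i j u z ui zj; rewrite addr0 addrC.
suff H : gmap_deg i (lcomp (gassocV U V W) (gpurer (gtens V W) u)) by exact: H.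
apply: gtens_map_deg => l k v w vl wk; rewrite lcompE addrC addrA.
by rewrite [gassocV _ _ _ _]gassocVE; do 2?apply: gpure_deg.
Qed.

Lemma gassoc_deg (U V W : gvect K) : gmap_deg 0 (gassoc U V W).
Proof.
apply: gtens_map_deg => i j z w zi wj; rewrite addr0.
suff H : gmap_deg j (lcomp (gassoc U V W) (gpurel (gtens U V) w)) by exact: H.
apply: gtens_map_deg => l k u v ul vk; rewrite lcompE -addrA.
by rewrite [gassoc _ _ _ _]gassocE; do 2?apply: gpure_deg.
Qed.

Lemma glunit_deg (V : gvect K) : gmap_deg 0 (glunit V).
Proof.
apply: gtens_map_deg => i j a v ai vj; rewrite addr0 glunitE.
have [i0|i0] := eqVneq i 0; first by rewrite i0 add0r; apply: gdegZ.
suff -> : (a : K) = 0 by rewrite scale0r; apply: gdeg0.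
by rewrite -[LHS]ai /= /gunit_proj (negPf i0).
Qed.

Section GHom.
Variables V W : gvect K.

(* linear maps that are finite sums of homogeneous ones *)
Inductive ghom_spec : (V -> W) -> Prop :=
| GHomDeg d (f : {linear V -> W}) of gmap_deg d f : ghom_spec f
| GHomAdd f g of ghom_spec f & ghom_spec g : ghom_spec (f + g).

Fact ghom_spec_lin f : ghom_spec f -> linear f.
Proof.
elim=> {f} [d f _|f g _ fl _ gl] a x y; first exact: linearP.
by rewrite /GRing.add /= fl gl scalerDr addrACA.
Qed.

Fact ghom_spec0 : ghom_spec 0.
Proof.
apply: (@GHomDeg 0 (mklin (linearP (\0 : {linear V -> W})))).
by move=> i x _; apply: gdeg0.
Qed.

Fact ghom_specL a f g : ghom_spec f -> ghom_spec g -> ghom_spec (a *: f + g).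
Proof.
move=> fP gP; apply: GHomAdd => //; elim: fP => {f g gP} [d f fd|f g _ fP _ gP].
  apply: (@GHomDeg d (mklin (linearP (a \*: f)))) => i x xi.
  by apply: gdegZ; apply: fd.
by rewrite scalerDr; apply: GHomAdd.
Qed.

Definition ghom_smod : smod (V -> W) := SMod ghom_spec0 ghom_specL.

Definition ghom_fun (f : lsub ghom_smod) : {linear V -> W} :=
  mklin (ghom_spec_lin (lvalS f)).

Lemma ghom_funE f : ghom_fun f = lval f :> (V -> W).
Proof. by []. Qed.

Lemma ghom_eq (f g : lsub ghom_smod) : ghom_fun f =1 ghom_fun g -> f = g.
Proof. by move=> fg; apply/val_inj/funext. Qed.

(* the component of degree p of f maps x of degree i to the component of
   degree i + p of f x *)
Definition ghom_component (p : int) (f : {linear V -> W}) : {linear V -> W} :=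
  glue (fun i => lcomp (gproj W (i + p)) f).

Fact ghom_component_deg p f : gmap_deg p (ghom_component p f).
Proof. by move=> i x xi; rewrite /ghom_component (glueE _ xi); apply: gdeg_proj. Qed.

Definition ghom_proj_fun p (f : lsub ghom_smod) : lsub ghom_smod :=
  mklsub (S := ghom_smod) (GHomDeg (@ghom_component_deg p (ghom_fun f))).

Fact ghom_proj_lin p : linear (ghom_proj_fun p).
Proof.
move=> a f g; apply: ghom_eq => x.
rewrite -[LHS]/(ghom_component p (ghom_fun (a *: f + g)) x).
rewrite -[RHS]/(a *: ghom_component p (ghom_fun f) x +
                ghom_component p (ghom_fun g) x).
elim/gdeg_ind: x => [|x y IHx IHy|k x xk].
- by rewrite !linear0 addr0.
- by rewrite !linearD IHx IHy addrACA.
by rewrite /ghom_component !(glueE _ xk) !lcompE -linearP.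
Qed.

Definition ghom_proj p : {linear lsub ghom_smod -> lsub ghom_smod} :=
  mklin (ghom_proj_lin p).

Fact ghom_projE i j (f : lsub ghom_smod) :
  gmap_deg i (ghom_fun f) -> ghom_proj j f = if j == i then f else 0.
Proof.
move=> fi; apply: ghom_eq => x.
have -> : ghom_fun (if j == i then f else 0) x =
          (if j == i then ghom_fun f x else 0) by case: ifP.
rewrite -[LHS]/(ghom_component j (ghom_fun f) x).
elim/gdeg_ind: x => [|x y IHx IHy|k x xk].
- by rewrite !linear0 if_same.
- by rewrite !linearD IHx IHy; case: ifP; rewrite ?addr0.
rewrite /ghom_component (glueE _ xk) lcompE (gproj_deg _ (fi _ _ xk)).
by rewrite (inj_eq (addrI k)).
Qed.

Fact ghom_gen (f : lsub ghom_smod) :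
  exists n (i : 'I_n -> int) (y : 'I_n -> lsub ghom_smod),
    (forall k, gmap_deg (i k) (ghom_fun (y k))) /\ f = \sum_k y k.
Proof.
case: f => f fP; have := fP => /asboolP fS.
elim: fS fP => {f} [d f fd|f g fS IHf gS IHg] fP.
  exists 1%N, (fun _ => d), (fun _ => LSub fP); split=> //.
  by rewrite big_ord1.
have [n [i [y [iy fE]]]] := IHf (introT (asboolP _) fS).
have [m [j [z [jz gE]]]] := IHg (introT (asboolP _) gS).
exists (n + m)%N, (fun k : 'I_(n + m) => match fintype.split k with inl a => i a | inr b => j b end),
  (fun k : 'I_(n + m) => match fintype.split k with inl a => y a | inr b => z b end); split.
  by move=> k; case: (fintype.split k).
rewrite big_split_ord /=.
transitivity (\sum_k y k + \sum_k z k).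
  by rewrite -fE -gE; apply: val_inj.
congr (_ + _); apply: eq_bigr => k _.
  by rewrite -[lshift m k]/(unsplit (inl k)) unsplitK.
by rewrite -[rshift n k]/(unsplit (inr k)) unsplitK.
Qed.

Definition ghom : gvect K := mkgvect ghom_projE ghom_gen.

Definition ghom_ap (f : ghom) : {linear V -> W} := ghom_fun f.

Lemma ghom_ext (f g : ghom) : ghom_ap f =1 ghom_ap g -> f = g.
Proof. exact: ghom_eq. Qed.

Lemma ghom_ap_lin a (f g : ghom) x :
  ghom_ap (a *: f + g) x = a *: ghom_ap f x + ghom_ap g x.
Proof. by []. Qed.

Lemma ghom_degP p (f : ghom) : gdeg p f <-> gmap_deg p (ghom_ap f).
Proof.
split=> [fp|]; last exact: (@mkgvect_deg _ _ _ _ ghom_projE ghom_gen).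
rewrite -fp; exact: ghom_component_deg.
Qed.

Definition mkghom (f : {linear V -> W}) (fP : ghom_spec f) : ghom :=
  mklsub (S := ghom_smod) fP.

Lemma mkghomE (f : {linear V -> W}) (fP : ghom_spec f) x :
  ghom_ap (mkghom fP) x = f x.
Proof. by []. Qed.

Lemma ghom_apP (f : ghom) : ghom_spec (ghom_ap f).
Proof. exact: (lvalS (f : lsub ghom_smod)). Qed.

Fact gev_bilin : bilin (fun (f : ghom) (v : V) => ghom_ap f v).
Proof. by split=> [v a f g|f]; [apply: ghom_ap_lin|apply: linearP]. Qed.

Definition gev : {linear gtens ghom V -> W} := tlift gev_bilin.

Lemma gevE (f : ghom) v : gev (gpure f v) = ghom_ap f v.
Proof. exact: tliftE. Qed.

Lemma gev_deg : gmap_deg 0 gev.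
Proof.
apply: gtens_map_deg => i j f v fi vj; rewrite gevE addr0 addrC.
exact: ((ghom_degP i f).1 fi).
Qed.

End GHom.
End GMap.

Section GHomOps.
Variable K : fieldType.

Lemma ghom_spec_ext (V W : gvect K) (f g : V -> W) :
  f =1 g -> ghom_spec f -> ghom_spec g.
Proof. by move=> /funext ->. Qed.

Lemma ghom_spec_comp (U V W : gvect K) (g : V -> W) (f : U -> V) :
  ghom_spec g -> ghom_spec f -> ghom_spec (fun x => g (f x)).
Proof.
move=> gP; elim=> {f} [d f fd|f f' _ IH _ IH'].
  elim: gP => {g} [e g ge|g g' _ IH _ IH'].
    exact: (GHomDeg (f := lcomp g f) (lcomp_deg ge fd)).
  exact: GHomAdd IH IH'.
apply: ghom_spec_ext (GHomAdd IH IH') => x.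
have gl := ghom_spec_lin gP; exact: esym (linearD (mklin gl) _ _).
Qed.

Lemma ksign_deg (V : gvect K) d : gmap_deg 0 (ksign V d).
Proof. by move=> i x xi; rewrite addr0 (ksignE _ xi); apply: gdegZ. Qed.

Section Pre.
Variables (V' V W : gvect K) (d : int) (g : {linear V' -> V}).
Hypothesis gd : gmap_deg d g.

Definition hpre_fun (f : ghom V W) : ghom V' W :=
  mkghom (f := lcomp (ghom_ap (ksign _ d f)) g)
    (ghom_spec_comp (ghom_apP (ksign _ d f)) (GHomDeg gd)).

Fact hpre_lin : linear hpre_fun.
Proof.
move=> a f h; apply: ghom_ext => x.
by rewrite -[LHS]/(ghom_ap (ksign _ d (a *: f + h)) (g x)) linearP.
Qed.

(* [g, W] for g of degree d: f |-> (-1)^(d|f|) f \o g *)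
Definition hpre : {linear ghom V W -> ghom V' W} := mklin hpre_lin.

Lemma hpreE f x : ghom_ap (hpre f) x = ghom_ap (ksign _ d f) (g x).
Proof. by []. Qed.

End Pre.

Section Post.
Variables (V W W' : gvect K) (d : int) (t : {linear W -> W'}).
Hypothesis td : gmap_deg d t.

Definition hpost_fun (f : ghom V W) : ghom V W' :=
  mkghom (f := lcomp t (ghom_ap f)) (ghom_spec_comp (GHomDeg td) (ghom_apP f)).

Fact hpost_lin : linear hpost_fun.
Proof.
move=> a f h; apply: ghom_ext => x.
by rewrite -[LHS]/(t (ghom_ap (a *: f + h) x)) ghom_ap_lin linearP.
Qed.

Definition hpost : {linear ghom V W -> ghom V W'} := mklin hpost_lin.

Lemma hpostE f x : ghom_ap (hpost f) x = t (ghom_ap f x).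
Proof. by []. Qed.

End Post.

Section Curry.
Variables (A B W : gvect K).

Fact hcurry_in_spec (f : gtens A B -> W) (x : A) :
  ghom_spec f -> ghom_spec (fun y => f (gpure x y)).
Proof.
elim=> {f} [d f fd|f g _ IHf _ IHg]; last exact: GHomAdd.
elim/gdeg_ind: x => [|x y IHx IHy|i x xi].
- apply: ghom_spec_ext (ghom_spec0 _ _) => y.
  by rewrite -[gpure 0 y]/(gpurel A y 0) !linear0.
- apply: ghom_spec_ext (GHomAdd IHx IHy) => z.
  by rewrite -[gpure (x + y) z]/(gpurel A z (x + y)) !linearD.
apply: (GHomDeg (d := i + d) (f := lcomp f (gpurer B x))) => j y yj.
by rewrite lcompE addrCA addrA; apply: fd; apply: gpure_deg.
Qed.

Definition hcurry_in (f : ghom (gtens A B) W) (x : A) : ghom B W :=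
  mkghom (f := lcomp (ghom_ap f) (gpurer B x))
    (hcurry_in_spec x (ghom_apP f)).

Fact hcurry_in_lin f : linear (hcurry_in f).
Proof.
move=> a x y; apply: ghom_ext => z.
rewrite -[LHS]/(ghom_ap f (gpurel A z (a *: x + y))) !linearP.
by rewrite ghom_ap_lin.
Qed.

Fact hcurry_spec f : ghom_spec (hcurry_in f).
Proof.
have [n [i [y [yi ->]]]] := ghom_gen f.
apply: (@ghom_spec_ext _ _ (\sum_k hcurry_in (y k))).
  move=> x; rewrite fct_sumE; apply: ghom_ext => z.
  pose ev (B W : gvect K) (z : B) :=
    mklin (fun a (f g : ghom B W) => ghom_ap_lin a f g z).
  rewrite -[LHS]/(ev _ _ z _) linear_sum.
  by rewrite -[RHS]/(ev _ _ (gpure x z) _) linear_sum.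
elim/big_rec: _ => [|k g _ gP]; first exact: ghom_spec0.
apply: GHomAdd => //.
apply: (@GHomDeg _ _ _ (i k) (mklin (hcurry_in_lin (y k)))) => j x xj.
apply/ghom_degP => l z zl; rewrite mkghomE lcompE addrCA addrA.
by apply: yi; apply: gpure_deg.
Qed.

Definition hcurry_fun (f : ghom (gtens A B) W) : ghom A (ghom B W) :=
  mkghom (f := mklin (hcurry_in_lin f)) (hcurry_spec f).

Fact hcurry_lin : linear hcurry_fun.
Proof. by move=> a f g; apply: ghom_ext => x; apply: ghom_ext. Qed.

(* F |-> (x |-> (y |-> F (x ⊗ y))) *)
Definition hcurry : {linear ghom (gtens A B) W -> ghom A (ghom B W)} :=
  mklin hcurry_lin.

Lemma hcurryE f x y :
  ghom_ap (ghom_ap (hcurry f) x) y = ghom_ap f (gpure x y).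
Proof. by []. Qed.

Fact huncurry_bilin (f : ghom A (ghom B W)) :
  bilin (fun x y => ghom_ap (ghom_ap f x) y).
Proof. by split=> [y a x z|x]; [rewrite linearP|apply: linearP]. Qed.

Definition huncurry_map (f : ghom A (ghom B W)) : {linear gtens A B -> W} :=
  tlift (huncurry_bilin f).

Fact huncurry_mapE f x y :
  huncurry_map f (gpure x y) = ghom_ap (ghom_ap f x) y.
Proof. exact: tliftE. Qed.

Fact huncurry_map_lin a f g x :
  huncurry_map (a *: f + g) x = a *: huncurry_map f x + huncurry_map g x.
Proof.
rewrite -[RHS]/((mklin (linearP ((a \*: huncurry_map f) \+ huncurry_map g)))  x).
move: x; apply: tens_ext => x y.
rewrite -[RHS]/(a *: huncurry_map f (gpure x y) + huncurry_map g (gpure x y)).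
by rewrite -[tpure x y]/(gpure x y) !huncurry_mapE ghom_ap_lin.
Qed.

Fact huncurry_spec f : ghom_spec (huncurry_map f).
Proof.
have [n [i [y [yi ->]]]] := ghom_gen f.
apply: (@ghom_spec_ext _ _ (\sum_k (huncurry_map (y k) : _ -> _))).
  move=> x; rewrite fct_sumE.
  pose ev (x : gtens A B) := mklin (fun a f g => huncurry_map_lin a f g x).
  by rewrite -[RHS]/(ev x _) linear_sum.
elim/big_rec: _ => [|k g _ gP]; first exact: ghom_spec0.
apply: GHomAdd => //; apply: (@GHomDeg _ _ _ (i k)).
apply: gtens_map_deg => j l x z xj zl.
rewrite huncurry_mapE addrAC addrC.
by have /ghom_degP := yi k _ _ xj; apply.
Qed.

Definition huncurry_fun (f : ghom A (ghom B W)) : ghom (gtens A B) W :=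
  mkghom (huncurry_spec f).

Fact huncurry_lin : linear huncurry_fun.
Proof.
move=> a f g; apply: ghom_ext => x.
exact: huncurry_map_lin.
Qed.

(* f |-> (x ⊗ y |-> f x y) *)
Definition huncurry : {linear ghom A (ghom B W) -> ghom (gtens A B) W} :=
  mklin huncurry_lin.

Lemma huncurryE f x y :
  ghom_ap (huncurry f) (gpure x y) = ghom_ap (ghom_ap f x) y.
Proof. exact: huncurry_mapE. Qed.

End Curry.

End GHomOps.

Record gsmod (K : fieldType) (V : gvect K) := GSMod {
  gsm :> smod V;
  gsm_stable : forall i x, gsm x -> gsm (gproj V i x) }.

Section SubQuot.
Variables (K : fieldType) (V : gvect K) (S : gsmod V).

Definition gsub_proj_fun i (x : lsub S) : lsub S :=
  mklsub (gsm_stable i (lvalS x)).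

Fact gsub_proj_lin i : linear (gsub_proj_fun i).
Proof.
by move=> a x y; apply: val_inj; exact: (linearP (gproj V i) a (lval x) (lval y)).
Qed.

Definition gsub_proj i : {linear lsub S -> lsub S} := mklin (gsub_proj_lin i).

Fact gsub_projE i j x :
  gsub_proj i (gsub_proj j x) = if i == j then gsub_proj j x else 0.
Proof. by apply: val_inj; case: eqP (gproj_proj i j (lval x)) => //. Qed.

Fact gsub_sum x : exists s : seq int, uniq s /\ x = \sum_(i <- s) gsub_proj i x.
Proof.
exists (gsupp (lval x)); split; first exact: gsupp_uniq.
apply: val_inj => /=; rewrite -[RHS]/(lincl S _) linear_sum.
exact: gsupp_sum.
Qed.

Definition gsubv : gvect K := GVect gsub_projE gsub_sum.

Definition gincl : {linear gsubv -> V} := lincl S.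

Lemma gincl_deg : gmap_deg 0 gincl.
Proof. by move=> i x; rewrite addr0 /gdeg => /(congr1 (@lval _ _ _)). Qed.

Fact gquot_proj_ker i x : S x -> lcomp (lpi S) (gproj V i) x = 0.
Proof. by move=> Sx; apply/lpi0P; apply: gsm_stable. Qed.

Definition gquot_proj i : {linear lquot S -> lquot S} :=
  lquot_map (gquot_proj_ker i).

Lemma gquot_proj_pi i x : gquot_proj i (lpi S x) = lpi S (gproj V i x).
Proof. exact: (lquot_mapE (gquot_proj_ker i)). Qed.

Fact gquot_projE i j x :
  gquot_proj i (gquot_proj j x) = if i == j then gquot_proj j x else 0.
Proof.
have [y ->] := lpi_surj x.
rewrite !gquot_proj_pi gproj_proj.
by case: eqP => // _; rewrite linear0.
Qed.

Fact gquot_sum x :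
  exists s : seq int, uniq s /\ x = \sum_(i <- s) gquot_proj i x.
Proof.
have [y ->] := lpi_surj x; exists (gsupp y); split; first exact: gsupp_uniq.
rewrite {1}(gsupp_sum y) linear_sum; apply: eq_bigr => i _.
by rewrite gquot_proj_pi.
Qed.

Definition gquotv : gvect K := GVect gquot_projE gquot_sum.

Definition gpi : {linear V -> gquotv} := lpi S.

Lemma gpi_deg : gmap_deg 0 gpi.
Proof.
move=> i x xi; rewrite addr0 /gdeg -[gproj _ _]/(gquot_proj i).
by rewrite [LHS]gquot_proj_pi xi.
Qed.

End SubQuot.

Section Powers.
Variables (K : fieldType) (C : gvect K).

(* C^{⊗k} = C ⊗ (C ⊗ (... ⊗ K)) *)
Fixpoint gpow (k : nat) : gvect K :=
  if k is k'.+1 then gtens C (gpow k') else gunit K.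

(* the isomorphism C^{⊗a} ⊗ C^{⊗b} -> C^{⊗(a + b)} *)
Fixpoint gcat (a b : nat) : {linear gtens (gpow a) (gpow b) -> gpow (a + b)} :=
  match a return {linear gtens (gpow a) (gpow b) -> gpow (a + b)} with
  | 0 => glunit (gpow b)
  | a'.+1 => lcomp (ktens 0 (lid C) (gcat a' b)) (gassoc C (gpow a') (gpow b))
  end.

Lemma gcat_deg a b : gmap_deg 0 (gcat a b).
Proof.
elim: a => [|a IH]; first exact: glunit_deg.
have := lcomp_deg (ktens_deg (@lid_deg _ C) IH) (@gassoc_deg _ C (gpow a) (gpow b)).
by rewrite !addr0.
Qed.

(* 1^{⊗p} ⊗ f ⊗ 1^{⊗r} for f of degree d *)
Fixpoint gins (p r q : nat) (d : int) (f : {linear C -> gpow q}) :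
    {linear gpow (p + r).+1 -> gpow (p + (q + r))} :=
  match p return {linear gpow (p + r).+1 -> gpow (p + (q + r))} with
  | 0 => lcomp (gcat q r) (ktens 0 f (lid (gpow r)))
  | p'.+1 => ktens d (lid C) (gins p' r d f)
  end.

Lemma gins_deg p r q d (f : {linear C -> gpow q}) :
  gmap_deg d f -> gmap_deg d (gins p r d f).
Proof.
move=> fd; elim: p => [|p IH].
  have := lcomp_deg (@gcat_deg q r) (ktens_deg fd (@lid_deg _ (gpow r))).
  by rewrite !addr0.
by have := ktens_deg (@lid_deg _ C) IH; rewrite add0r.
Qed.

(* the identity of C^{⊗m} = C^{⊗n} when m = n *)
Definition gcast (m n : nat) : {linear gpow m -> gpow n} :=
  match eqVneq m n with
  | EqNotNeq e => match e in _ = k return {linear gpow m -> gpow k} with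
                  | erefl => lid (gpow m)
                  end
  | NeqNotEq _ => mklin (linearP (\0 : {linear gpow m -> gpow n}))
  end.

Lemma gcast_id m x : gcast m m x = x.
Proof.
rewrite /gcast; case: eqVneq => [e|]; last by rewrite eqxx.
by rewrite (eq_axiomK e).
Qed.

Lemma gcast_deg m n : gmap_deg 0 (gcast m n).
Proof.
have [->|mn] := eqVneq m n; first by move=> i x xi; rewrite gcast_id addr0.
rewrite /gcast; case: eqVneq => [e|_ i x _]; last exact: gdeg0.
by rewrite e eqxx in mn.
Qed.

End Powers.

Arguments hpre {K V' V W d g} gd.
Arguments hpost {K V W W' d t} td.
Arguments hcurry {K A B W}.
Arguments huncurry {K A B W}.

(* Structure maps are numbered from 0: index k is for w_{k+1} or t_{k+1}, of
   degree 2 - (k+1), and the relation with index n is the one for n+1.  In the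
   sums p, q, r, a, b, c stand for the usual indices of the A-infinity
   relations, lowered by 1 when these are required to be positive. *)
Definition adeg (k : nat) : int := 2 - (k.+1)%:Z.

Record acoalg (K : fieldType) := ACoalg {
  ac :> gvect K;
  aw : forall k, {linear ac -> gpow ac k.+1};
  aw_deg : forall k, gmap_deg (adeg k) (aw k);
  aw_fin : forall x, exists n, forall k, (n <= k)%N -> aw k x = 0;
  aw_rel : forall n x,
    \sum_(p < n.+1) \sum_(q < n.+1) \sum_(r < n.+1 | (p + q + r == n)%N)
      (-1) ^+ (p * q.+1 + r) *:
        gcast ac (p + (q.+1 + r)) n.+1
          (gins p r (adeg q) (aw q) (aw (p + r) x)) = 0 }.

Definition acoalg_even (K : fieldType) (C : acoalg K) : Prop :=
  forall k, odd k.+1 -> forall x, aw C k x = 0.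

Record lcomod_on (K : fieldType) (C : acoalg K) (P : gvect K) := LComodOn {
  lw : forall k, {linear P -> gtens (gpow C k) P};
  lw_deg : forall k, gmap_deg (adeg k) (lw k);
  lw_rel : forall n x,
    \sum_(p < n.+1) \sum_(q < n.+1) \sum_(r < n.+1 | (p + q + r).+1 == n)
      (-1) ^+ (p * q.+1 + r.+1) *:
        ktens 0 (gcast C (p + (q.+1 + r)) n) (lid P)
          (ktens 0 (gins p r (adeg q) (aw C q)) (lid P) (lw (p + r).+1 x))
    + \sum_(a < n.+1) \sum_(b < n.+1 | (a + b == n)%N)
      (-1) ^+ (a * b.+1) *:
        ktens 0 (lcomp (gcast C (a + b) n) (gcat C a b)) (lid P)
          (gassocV (gpow C a) (gpow C b) P
            (ktens (adeg b) (lid (gpow C a)) (lw b) (lw a x))) = 0 }.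

Definition lcomod_even (K : fieldType) (C : acoalg K) (P : gvect K)
    (s : lcomod_on C P) : Prop :=
  forall k, odd k.+1 -> forall x, lw s k x = 0.

Record rcomod_on (K : fieldType) (D : acoalg K) (P : gvect K) := RComodOn {
  rw : forall k, {linear P -> gtens P (gpow D k)};
  rw_deg : forall k, gmap_deg (adeg k) (rw k);
  rw_rel : forall n x,
    \sum_(p < n.+1) \sum_(q < n.+1) \sum_(r < n.+1 | (p + q + r).+1 == n)
      (-1) ^+ (p.+1 * q.+1 + r) *:
        ktens 0 (lid P) (gcast D (p + (q.+1 + r)) n)
          (ktens (adeg q) (lid P) (gins p r (adeg q) (aw D q))
            (rw (p + r).+1 x))
    + \sum_(b < n.+1) \sum_(c < n.+1 | (b + c == n)%N)
      (-1) ^+ c *: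
        ktens 0 (lid P) (lcomp (gcast D (b + c) n) (gcat D b c))
          (gassoc P (gpow D b) (gpow D c)
            (ktens 0 (rw b) (lid (gpow D c)) (rw c x))) = 0 }.

Definition rcomod_even (K : fieldType) (D : acoalg K) (P : gvect K)
    (s : rcomod_on D P) : Prop :=
  forall k, odd k.+1 -> forall x, rw s k x = 0.

Record rcomod (K : fieldType) (D : acoalg K) := RComod {
  rc :> gvect K;
  rcomod_str : rcomod_on D rc }.

Definition rcw (K : fieldType) (D : acoalg K) (Q : rcomod D) (k : nat) :
  {linear Q -> gtens Q (gpow D k)} := rw (rcomod_str Q) k.

(* The component of w_{q+1} with values in degree m, that is with
   n_1 + ... + n_{q+1} = - m, is multiplied by (-1)^((q+1)(- m + 1)). *)
Definition aw' (K : fieldType) (C : acoalg K) (q : nat) :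
    {linear C -> gpow C q.+1} :=
  lcomp
    (glue (fun m =>
      ((-1 : K) ^ ((q.+1)%:Z * (- m + 1))) \*: lid (gpow C q.+1)))
    (aw C q).

Lemma aw'_deg (K : fieldType) (C : acoalg K) q : gmap_deg (adeg q) (aw' C q).
Proof.
move=> i x xi; have wi := @aw_deg _ C q i x xi.
by rewrite /aw' lcompE (glueE _ wi); apply: gdegZ.
Qed.

Record contramod_on (K : fieldType) (C : acoalg K) (M : gvect K) := ContraOn {
  ct : forall k, {linear ghom (gpow C k) M -> M};
  ct_deg : forall k, gmap_deg (adeg k) (ct k);
  ct_rel : forall n (f : ghom (gpow C n) M),
    \sum_(p < n.+1) \sum_(q < n.+1) \sum_(r < n.+1 | (p + q + r).+1 == n)
      (-1) ^+ (p + q.+1 * r.+1) *: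
        ct (p + r).+1 (hpre (gins_deg (p := p) (r := r) (@aw'_deg K C q))
          (hpre (@gcast_deg K C (p + (q.+1 + r)) n) f))
    + \sum_(a < n.+1) \sum_(b < n.+1 | (a + b == n)%N)
      (-1) ^+ a *:
        ct a (hpost (@ct_deg b)
          (hcurry (hpre (@gcat_deg K C a b)
            (hpre (@gcast_deg K C (a + b) n) f)))) = 0 }.

Record contramod (K : fieldType) (C : acoalg K) := Contra {
  cc :> gvect K;
  contramod_str : contramod_on C cc }.

Definition cct (K : fieldType) (C : acoalg K) (M : contramod C) (k : nat) :
  {linear ghom (gpow C k) M -> M} := ct (contramod_str M) k.

Record category := Category {
  ob :> Type;
  mor : ob -> ob -> Type;
  idm : forall a, mor a a;
  compm : forall a b c, mor b c -> mor a b -> mor a c;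
  compm1 : forall a b (f : mor a b), compm f (idm a) = f;
  comp1m : forall a b (f : mor a b), compm (idm b) f = f;
  compmA : forall a b c d (h : mor c d) (g : mor b c) (f : mor a b),
    compm h (compm g f) = compm (compm h g) f }.

Record is_functor (A B : category) (F : A -> B)
    (F1 : forall a b : A, mor a b -> mor (F a) (F b)) : Prop := IsFunctor {
  functor_id : forall a, F1 a a (idm a) = idm (F a);
  functor_comp : forall a b c (g : mor b c) (f : mor a b),
    F1 a c (compm g f) = compm (F1 b c g) (F1 a b f) }.

Definition is_adjunction (A B : category) (F : A -> B) (G : B -> A)
    (F1 : forall a b : A, mor a b -> mor (F a) (F b))
    (G1 : forall a b : B, mor a b -> mor (G a) (G b))
    (Phi : forall a b, mor (F a) b -> mor a (G b)) : Prop :=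
  (forall a b, bijective (Phi a b)) /\
  (forall a a' b b' (h : mor a' a) (g : mor b b') (f : mor (F a) b),
    Phi a' b' (compm g (compm f (F1 a' a h))) =
    compm (G1 b b' g) (compm (Phi a b f) h)).

Lemma ktens0E (K : fieldType) (V V' W W' : gvect K) (f : {linear V -> V'})
    (g : {linear W -> W'}) v w :
  ktens 0 f g (gpure v w) = gpure (f v) (g w).
Proof.
rewrite ktensE; congr (gpure (f _) _); rewrite -[RHS]/(lid V v).
move: v; apply: glin_ext => i v vi.
by rewrite (ksignE _ vi) mul0r expr0z scale1r.
Qed.

Lemma ktens0_linl (K : fieldType) (V V' W W' : gvect K) a
    (h f g : {linear V -> V'}) (u : {linear W -> W'}) z :
  (forall v, h v = a *: f v + g v) ->
  ktens 0 h u z = a *: ktens 0 f u z + ktens 0 g u z.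
Proof.
move=> hE.
rewrite -[RHS]/(mklin (linearP ((a \*: ktens 0 f u) \+ ktens 0 g u)) z).
move: z; apply: tens_ext => v w.
rewrite -[RHS]/(a *: ktens 0 f u (gpure v w) + ktens 0 g u (gpure v w)).
rewrite -[tpure v w]/(gpure v w) !ktens0E hE.
exact: (linearP (gpurel V' (u w))).
Qed.

Lemma ktens_id (K : fieldType) (V W : gvect K) z :
  ktens 0 (lid V) (lid W) z = z.
Proof.
rewrite -[RHS]/(lid (gtens V W) z).
by move: z; apply: tens_ext => v w; exact: ktens0E.
Qed.

Lemma ktens_comp (K : fieldType) (V V' V'' W W' W'' : gvect K)
    (f' : {linear V' -> V''}) (f : {linear V -> V'})
    (g' : {linear W' -> W''}) (g : {linear W -> W'}) z :
  ktens 0 (lcomp f' f) (lcomp g' g) z = ktens 0 f' g' (ktens 0 f g z).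
Proof.
rewrite -[RHS]/(lcomp (ktens 0 f' g') (ktens 0 f g) z).
move: z; apply: tens_ext => v w; rewrite lcompE.
by rewrite -[tpure v w]/(gpure v w) !ktens0E.
Qed.

Lemma lcomp_deg0 (K : fieldType) (U V W : gvect K) (g : {linear V -> W})
    (f : {linear U -> V}) :
  gmap_deg 0 g -> gmap_deg 0 f -> gmap_deg 0 (lcomp g f).
Proof. by move=> gd fd; have := lcomp_deg gd fd; rewrite addr0. Qed.

Lemma lin_eq (K : fieldType) (U V : lmodType K) (f g : {linear U -> V}) :
  f =1 g -> f = g.
Proof.
case: f g => f fc [g gc] /= /funext fg; move: gc; rewrite -fg => gc.
congr GRing.Linear.Pack; case: fc gc => [[f1] [f2]] [[g1] [g2]].
by rewrite (Prop_irrelevance f1 g1) (Prop_irrelevance f2 g2).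
Qed.

Section RComodCat.
Variables (K : fieldType) (D : acoalg K).

Record rcomod_hom (P Q : rcomod D) := RComodHom {
  rh :> {linear P -> Q};
  rh_deg : gmap_deg 0 rh;
  rh_comp : forall k x,
    rcw Q k (rh x) = ktens 0 rh (lid (gpow D k)) (rcw P k x) }.

Lemma rcomod_hom_eq (P Q : rcomod D) (f g : rcomod_hom P Q) :
  rh f =1 rh g -> f = g.
Proof.
case: f g => f f1 f2 [g g1 g2] /= /lin_eq fg; move: g1 g2; rewrite -fg => g1 g2.
by rewrite (Prop_irrelevance f1 g1) (Prop_irrelevance f2 g2).
Qed.

Fact rcomod_id_comp (P : rcomod D) k x :
  rcw P k (lid P x) = ktens 0 (lid P) (lid (gpow D k)) (rcw P k x).
Proof. by rewrite ktens_id. Qed.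

Definition rcomod_id P : rcomod_hom P P :=
  RComodHom (@lid_deg K P) (@rcomod_id_comp P).

Fact rcomod_comp_comp (P Q T : rcomod D) (g : rcomod_hom Q T)
    (f : rcomod_hom P Q) k x :
  rcw T k (lcomp g f x) = ktens 0 (lcomp g f) (lid (gpow D k)) (rcw P k x).
Proof. by rewrite lcompE !rh_comp (ktens_comp _ _ (lid _)). Qed.

Definition rcomod_comp (P Q T : rcomod D) (g : rcomod_hom Q T)
    (f : rcomod_hom P Q) : rcomod_hom P T :=
  RComodHom (lcomp_deg0 (@rh_deg _ _ g) (@rh_deg _ _ f))
    (@rcomod_comp_comp P Q T g f).

(* the category M^D *)
Definition rcomod_cat : category.
Proof.
by apply: (@Category (rcomod D) rcomod_hom rcomod_id rcomod_comp) => *;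
  apply: rcomod_hom_eq.
Defined.

End RComodCat.

Section ContraCat.
Variables (K : fieldType) (C : acoalg K).

Record contramod_hom (M M' : contramod C) := ContraHom {
  ch :> {linear M -> M'};
  ch_deg : gmap_deg 0 ch;
  ch_comp : forall k (f : ghom (gpow C k) M),
    ch (cct M k f) = cct M' k (hpost ch_deg f) }.

Lemma contramod_hom_eq (M M' : contramod C) (f g : contramod_hom M M') :
  ch f =1 ch g -> f = g.
Proof.
case: f g => f f1 f2 [g g1 g2] /= /lin_eq fg.
move: g1 g2; rewrite -fg => g1; rewrite -(Prop_irrelevance f1 g1) => g2.
by rewrite (Prop_irrelevance f2 g2).
Qed.

Fact contramod_id_comp (M : contramod C) k (f : ghom (gpow C k) M) :
  lid M (cct M k f) = cct M k (hpost (@lid_deg K M) f).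
Proof. by congr (cct M k _); apply: ghom_ext. Qed.

Definition contramod_id M : contramod_hom M M :=
  ContraHom (@contramod_id_comp M).

Fact contramod_comp_comp (M M' M'' : contramod C) (g : contramod_hom M' M'')
    (f : contramod_hom M M') k (u : ghom (gpow C k) M) :
  lcomp g f (cct M k u) =
  cct M'' k (hpost (lcomp_deg0 (@ch_deg _ _ g) (@ch_deg _ _ f)) u).
Proof.
by rewrite lcompE !ch_comp; congr (cct M'' k _); apply: ghom_ext.
Qed.

Definition contramod_comp (M M' M'' : contramod C) (g : contramod_hom M' M'')
    (f : contramod_hom M M') : contramod_hom M M'' :=
  ContraHom (@contramod_comp_comp M M' M'' g f).

(* the category M_{[C,-]} *)
Definition contramod_cat : category.
Proof.
by apply: (@Category (contramod C) contramod_hom contramod_id contramod_comp) => *;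
  apply: contramod_hom_eq.
Defined.

End ContraCat.

Record cdspace (K : fieldType) (C D : acoalg K) := CDSpace {
  cd :> gvect K;
  cdl : lcomod_on C cd;
  cdr : rcomod_on D cd }.

Section CDSpace.
Variables (K : fieldType) (C D : acoalg K).
Implicit Types (N : cdspace C D) (M : contramod C) (Q : rcomod D).

Definition cd_even N : Prop := lcomod_even (cdl N) /\ rcomod_even (cdr N).

Definition cd_commuting N : Prop := forall k l (x : N),
  gassoc (gpow C k) N (gpow D l)
    (ktens 0 (lw (cdl N) k) (lid (gpow D l)) (rw (cdr N) l x)) =
  ktens (adeg l) (lid (gpow C k)) (rw (cdr N) l) (lw (cdl N) k x).

Definition cd_rcomod N : rcomod D := RComod (cdr N).

Section Contratensor.
Variables (M : contramod C) (N : cdspace C D).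

(* the two maps, for k+1, [C^{⊗k}, M] ⊗ N -> M ⊗ N *)
Definition boxt_ev k : {linear gtens (ghom (gpow C k) M) N -> gtens M N} :=
  lcomp (ktens 0 (gev (gpow C k) M) (lid N))
    (lcomp (gassocV (ghom (gpow C k) M) (gpow C k) N)
      (ktens (adeg k) (lid (ghom (gpow C k) M)) (lw (cdl N) k))).

Definition boxt_act k : {linear gtens (ghom (gpow C k) M) N -> gtens M N} :=
  ktens 0 (cct M k) (lid N).

Lemma boxt_ev_deg k : gmap_deg (adeg k) (boxt_ev k).
Proof.
have h := lcomp_deg (ktens_deg (@gev_deg K (gpow C k) M) (@lid_deg K N))
  (lcomp_deg (@gassocV_deg K (ghom (gpow C k) M) (gpow C k) N)
    (ktens_deg (@lid_deg K (ghom (gpow C k) M)) (@lw_deg _ _ _ (cdl N) k))).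
by move: h; rewrite !addr0 add0r.
Qed.

Lemma boxt_act_deg k : gmap_deg (adeg k) (boxt_act k).
Proof.
have h := ktens_deg (@ct_deg _ _ _ (contramod_str M) k) (@lid_deg K N).
by move: h; rewrite addr0.
Qed.

(* the image of the difference of the two maps out of the direct sum *)
Definition boxt_rel (z : gtens M N) : Prop :=
  exists n (y : forall k, gtens (ghom (gpow C k) M) N),
    z = \sum_(k < n) (boxt_ev k (y k) - boxt_act k (y k)).

Fact boxt_rel0 : boxt_rel 0.
Proof. by exists 0%N, (fun=> 0); rewrite big_ord0. Qed.

Fact boxt_relL a z t : boxt_rel z -> boxt_rel t -> boxt_rel (a *: z + t).
Proof.
move=> [n [y ->]] [m [u ->]].
pose tr j (y : forall k, gtens (ghom (gpow C k) M) N) k :=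
  if (k < j)%N then y k else 0.
have trE j (v : forall k, gtens (ghom (gpow C k) M) N) i : (j <= i)%N ->
    \sum_(k < j) (boxt_ev k (v k) - boxt_act k (v k)) =
    \sum_(k < i) (boxt_ev k (tr j v k) - boxt_act k (tr j v k)).
  move=> ji.
  rewrite (big_ord_widen i (fun k => boxt_ev k (v k) - boxt_act k (v k)) ji).
  rewrite big_mkcond; apply: eq_bigr => k _; rewrite /tr; case: ifP => // _.
  by rewrite (linear0 (boxt_ev k)) (linear0 (boxt_act k)) subr0.
exists (n + m)%N, (fun k => a *: tr n y k + tr m u k).
rewrite (trE n y (n + m)%N) ?leq_addr// (trE m u (n + m)%N) ?leq_addl//.
rewrite scaler_sumr -big_split; apply: eq_bigr => k _.
by rewrite (linearP (boxt_ev k)) (linearP (boxt_act k)) opprD addrACA -scalerBr.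
Qed.

Definition boxt_smod : smod (gtens M N) := SMod boxt_rel0 boxt_relL.

Fact boxt_rel_stable i z : boxt_smod z -> boxt_smod (gproj (gtens M N) i z).
Proof.
move=> [n [y ->]]; exists n, (fun k => gproj _ (i - adeg k) (y k)).
rewrite linear_sum; apply: eq_bigr => k _.
rewrite linearB (gmap_proj _ _ (@boxt_ev_deg k)).
by rewrite (gmap_proj _ _ (@boxt_act_deg k)).
Qed.

(* M ⊠_C N with the projection from M ⊗ N *)
Definition boxt : gvect K := gquotv (GSMod boxt_rel_stable).

Definition boxt_pi : {linear gtens M N -> boxt} := gpi (GSMod boxt_rel_stable).

(* the coactions of s are induced by the maps M ⊗ w^R_k *)
Definition boxt_induced (s : rcomod_on D boxt) : Prop :=
  forall k z, rw s k (boxt_pi z) =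
    ktens 0 boxt_pi (lid (gpow D k))
      (gassocV M N (gpow D k) (ktens (adeg k) (lid M) (rw (cdr N) k) z)).

End Contratensor.

Section RHom.
Variables Q Q' : rcomod D.

(* Q -> Q' of degree p, read as a morphism Q[-p] -> Q' with Koszul sign *)
Definition rcompat (p : int) (f : {linear Q -> Q'}) : Prop := forall k x,
  rcw Q' k (f x) =
  (-1) ^ (p * adeg k) *: ktens 0 f (lid (gpow D k)) (rcw Q k x).

Definition rhom_spec (f : ghom Q Q') : Prop :=
  forall p, rcompat p (ghom_ap (gproj (ghom Q Q') p f)).

Fact rhom_specL a f g : rhom_spec f -> rhom_spec g -> rhom_spec (a *: f + g).
Proof.
move=> fP gP p k x; set P := gproj (ghom Q Q') p.
have E y : ghom_ap (P (a *: f + g)) y = a *: ghom_ap (P f) y + ghom_ap (P g) y.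
  by rewrite -ghom_ap_lin; congr (ghom_ap _ y); apply: linearP.
rewrite E linearP fP gP (ktens0_linl _ _ E).
by rewrite scalerDr !scalerA mulrC.
Qed.

Fact rhom_spec0 : rhom_spec 0.
Proof.
move=> p k x; rewrite (linear0 (gproj (ghom Q Q') p)).
rewrite (ktens0_linl (a := -1) (f := ghom_ap 0) (g := ghom_ap 0)).
  by rewrite scaleN1r addNr scaler0 -[ghom_ap 0 x]/(0 : Q') linear0.
by move=> y; rewrite scaleN1r addNr.
Qed.

Definition rhom_smod : smod (ghom Q Q') := SMod rhom_spec0 rhom_specL.

Fact rhom_stable i f : rhom_smod f -> rhom_smod (gproj (ghom Q Q') i f).
Proof.
move=> fP p; rewrite gproj_proj; case: eqP => [->|_]; first exact: fP.
by have := rhom_spec0 p; rewrite (linear0 (gproj (ghom Q Q') p)).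
Qed.

(* [Q, Q']^D *)
Definition rhom : gvect K := gsubv (GSMod rhom_stable).

Definition rhom_incl : {linear rhom -> ghom Q Q'} := gincl (GSMod rhom_stable).

Lemma rhom_incl_deg : gmap_deg 0 rhom_incl.
Proof. exact: gincl_deg. Qed.

End RHom.

(* the contramodule structure of [N, Q]^D: t_k is the composite of
   f |-> (c ⊗ n |-> f c n) and of the precomposition with w^L_k *)
Definition rhom_induced N Q (s : contramod_on C (rhom (cd_rcomod N) Q)) : Prop :=
  forall k (f : ghom (gpow C k) (rhom (cd_rcomod N) Q)),
    rhom_incl (cd_rcomod N) Q (ct s k f) =
    hpre (@lw_deg _ _ _ (cdl N) k)
      (huncurry (hpost (@rhom_incl_deg (cd_rcomod N) Q) f)).

End CDSpace.

(* Main.v *)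
(* By evenness every structure map either vanishes or has even degree, so all
   Koszul signs disappear, including those of w', and the tensor products of
   maps become strictly functorial.  (M itself need not be even: for even k
   the coequalizer just kills the elements t_k(f) ⊗ n.)  The coaction on M ⊠ N
   is determined by the requirement that every n |-> pi (m ⊗ n) commute with
   the coactions; it is well defined because w^L and w^R commute.  Similarly
   the contraaction on [N, Q]^D sends f to n |-> f^(w^L n), where f^ is the
   uncurried f, and its relations are minus the relations of w^L composed with
   f^.  The adjunction is the restriction of currying: a map M ⊗ N -> Q factors
   through M ⊠ N exactly when its transpose is a contramodule map. *)
Require Import Defs.
From mathcomp Require Import all_boot all_order all_algebra zify.

Set Implicit Arguments.
Unset Strict Implicit.
Unset Printing Implicit Defensive.

Import GRing.Theory.
Local Open Scope ring_scope.

(** * Disappearance of the Koszul signs under evenness *)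

Section UnsignedTensor.
Variable K : fieldType.

(** [adeg k] is 1 - k because indices are shifted by one, so an odd index means an even degree. *)
Lemma sign_adeg k i : odd k -> (-1) ^ (adeg k * i) = 1 :> K.
Proof.
move=> k_odd; rewrite -exprz_exp -[RHS](exp1rz _ i); congr (_ ^ i).
have -> : adeg k = - ((k./2).*2)%:Z.
  by rewrite /adeg -{1}(odd_double_half k) k_odd; lia.
by rewrite -exprz_inv invrN1 -exprnP -signr_odd odd_double.
Qed.

Lemma ksign_adeg (V : gvect K) k (v : V) : odd k -> ksign V (adeg k) v = v.
Proof.
move=> k_odd; rewrite -[RHS]/(lid V v); move: v; apply: glin_ext => i v vi.
by rewrite (ksignE _ vi) sign_adeg ?scale1r.
Qed.

Lemma gpure0r (V W : gvect K) (v : V) : gpure v (0 : W) = 0.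
Proof. exact: (linear0 (gpurer W v)). Qed.

Lemma gpure0l (V W : gvect K) (w : W) : gpure (0 : V) w = 0.
Proof. exact: (linear0 (gpurel V w)). Qed.

Lemma tens_pure_ext (V W : gvect K) (U : lmodType K)
    (f g : {linear gtens V W -> U}) :
  (forall v w, f (gpure v w) = g (gpure v w)) -> f =1 g.
Proof. exact: tens_ext. Qed.

(** The two cases of evenness: for odd [k] the degree is even and the sign is 1; for even [k] both
    sides vanish together with [g]. *)
Lemma ktens_adeg (V V' W W' : gvect K) k (f : {linear V -> V'})
    (g : {linear W -> W'}) :
  (odd k.+1 -> forall w, g w = 0) -> ktens (adeg k) f g =1 ktens 0 f g.
Proof.
move=> g0; apply: tens_pure_ext => v w; rewrite ktens0E ktensE.
have [k_odd|/g0->] := boolP (odd k); first by rewrite ksign_adeg.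
by rewrite !gpure0r.
Qed.

Lemma ktens_ext (V V' W W' : gvect K) d (f f' : {linear V -> V'})
    (g g' : {linear W -> W'}) :
  f =1 f' -> g =1 g' -> ktens d f g =1 ktens d f' g'.
Proof. by move=> /lin_eq -> /lin_eq ->. Qed.

Lemma ktens_eq0l (V V' W W' : gvect K) d (f : {linear V -> V'})
    (g : {linear W -> W'}) z : (forall v, f v = 0) -> ktens d f g z = 0.
Proof.
move=> f0; rewrite -[RHS]/((\0 : {linear _ -> gtens V' W'}) z).
by move: z; apply: tens_pure_ext => v w; rewrite ktensE f0 gpure0l.
Qed.

Lemma ktens_eq0r (V V' W W' : gvect K) d (f : {linear V -> V'})
    (g : {linear W -> W'}) z : (forall w, g w = 0) -> ktens d f g z = 0.
Proof.
move=> g0; rewrite -[RHS]/((\0 : {linear _ -> gtens V' W'}) z).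
by move: z; apply: tens_pure_ext => v w; rewrite ktensE g0 gpure0r.
Qed.

Lemma ktens_swap (V V' W W' : gvect K) (f : {linear V -> V'})
    (g : {linear W -> W'}) z :
  ktens 0 (lid V') g (ktens 0 f (lid W) z) =
  ktens 0 f (lid W') (ktens 0 (lid V) g z).
Proof. by rewrite -!ktens_comp; apply: ktens_ext z. Qed.

Lemma gassocV_pure (U V W : gvect K) (u : U) (z : gtens V W) :
  gassocV U V W (gpure u z) = ktens 0 (gpurer V u) (lid W) z.
Proof.
rewrite -[LHS]/(lcomp (gassocV U V W) (gpurer _ u) z).
move: z; apply: tens_pure_ext => v w; rewrite ktens0E.
exact: gassocVE.
Qed.

Lemma gassoc_natural (U U' V W : gvect K) (f : {linear U -> U'}) z :
  gassoc U' V W (ktens 0 (ktens 0 f (lid V)) (lid W) z) =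
  ktens 0 f (lid (gtens V W)) (gassoc U V W z).
Proof.
rewrite -[LHS]/(lcomp (gassoc U' V W) (ktens 0 (ktens 0 f (lid V)) (lid W)) z).
rewrite -[RHS]/(lcomp (ktens 0 f (lid (gtens V W))) (gassoc U V W) z).
move: z; apply: tens_pure_ext => x w; rewrite !lcompE ktens0E.
rewrite -[LHS]/(lcomp (gassoc U' V W)
  (lcomp (gpurel _ w) (ktens 0 f (lid V))) x).
rewrite -[RHS]/(lcomp (ktens 0 f (lid (gtens V W)))
  (lcomp (gassoc U V W) (gpurel _ w)) x).
move: x; apply: tens_pure_ext => u v; rewrite !lcompE ktens0E.
rewrite [X in _ = ktens _ _ _ X]gassocE ktens0E; exact: gassocE.
Qed.

Lemma gins_ext (C : gvect K) p r q d (f g : {linear C -> gpow C q}) :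
  f =1 g -> gins p r d f =1 gins p r d g.
Proof. by move/lin_eq->. Qed.

Lemma gins_eq0 (C : gvect K) p r q d (f : {linear C -> gpow C q}) :
  (forall x, f x = 0) -> forall x, gins p r d f x = 0.
Proof.
move=> f0; elim: p => [|p IH] x; last exact: ktens_eq0r.
rewrite -[LHS]/(gcat C q r (ktens 0 f (lid (gpow C r)) x)).
by rewrite ktens_eq0l ?linear0.
Qed.

(** For odd [q] the exponent of the extra sign has the even factor [q + 1]; for even [q] the map
    [aw C q] is zero. *)
Lemma aw'_even (C : acoalg K) q : acoalg_even C -> aw' C q =1 aw C q.
Proof.
move=> C_even x; rewrite /aw' lcompE.
have [q_odd|/C_even->] := boolP (odd q); last by rewrite linear0.
rewrite -[RHS]/(lid _ (aw C q x)); move: (aw C q x).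
apply: glin_ext => i z zi; rewrite (glueE _ zi) /= -exprz_exp -exprnP.
by rewrite -signr_odd /= q_odd exp1rz scale1r.
Qed.

End UnsignedTensor.

Lemma rw_adeg (K : fieldType) (D : acoalg K) (P : gvect K) (s : rcomod_on D P)
    (V V' : gvect K) (f : {linear V -> V'}) k :
  rcomod_even s -> ktens (adeg k) f (rw s k) =1 ktens 0 f (rw s k).
Proof. by move=> s_even; apply: ktens_adeg => /s_even. Qed.

Lemma lw_adeg (K : fieldType) (C : acoalg K) (P : gvect K) (s : lcomod_on C P)
    (V V' : gvect K) (f : {linear V -> V'}) k :
  lcomod_even s -> ktens (adeg k) f (lw s k) =1 ktens 0 f (lw s k).
Proof. by move=> s_even; apply: ktens_adeg => /s_even. Qed.

Lemma gins_adeg (K : fieldType) (C : acoalg K) (V V' : gvect K) p r q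
    (f : {linear V -> V'}) : acoalg_even C ->
  ktens (adeg q) f (gins p r (adeg q) (aw C q)) =1
  ktens 0 f (gins p r (adeg q) (aw C q)).
Proof. by move=> C_even; apply: ktens_adeg => /C_even; apply: gins_eq0. Qed.

(** A homogeneous class has a homogeneous representative: the component in that degree of any
    representative. *)
Lemma gquotv_map_deg (K : fieldType) (V W : gvect K) (S : gsmod V) d
    (f : {linear gquotv S -> W}) :
  gmap_deg d (lcomp f (gpi S)) -> gmap_deg d f.
Proof.
move=> fd i z; rewrite /gdeg => <-; have [y ->] := lpi_surj z.
rewrite -[gproj (gquotv S) i (lpi S y)]/(gquot_proj S i (lpi S y)).
by rewrite gquot_proj_pi; apply: fd (gdeg_proj i y).
Qed.

(* No degree or Koszul sign is attached to f, so that this makes sense for the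
   maps n |-> pi (m ⊗ n) with m not homogeneous. *)
Definition coacts (K : fieldType) (D : acoalg K) (N X : gvect K)
    (s : rcomod_on D N) (rho : forall l, {linear X -> gtens X (gpow D l)})
    (f : {linear N -> X}) :=
  forall l x, rho l (f x) = ktens 0 f (lid (gpow D l)) (rw s l x).

(** * Transport of the comodule relations *)

Lemma linear_fct_sum (K : fieldType) (U V : lmodType K) (I : Type) (r : seq I)
    (P : pred I) (F : I -> U -> V) :
  (forall i, linear (F i)) -> linear (fun x => \sum_(i <- r | P i) F i x).
Proof.
move=> F_lin a x y; rewrite scaler_sumr -big_split.
by apply: eq_bigr => i _; apply: F_lin.
Qed.

Lemma linear_fct_add (K : fieldType) (U V : lmodType K) (f g : U -> V) :
  linear f -> linear g -> linear (fun x => f x + g x).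
Proof. by move=> fl gl a x y; rewrite fl gl scalerDr addrACA. Qed.

Lemma linear_fct_scale (K : fieldType) (U V : lmodType K) (c : K)
    (f : {linear U -> V}) : linear (fun x => c *: f x).
Proof. by move=> a x y; rewrite linearP scalerDr !scalerA mulrC. Qed.

Section CoactionDefect.
Variables (K : fieldType) (D : acoalg K) (X : gvect K).
Variable rho : forall l, {linear X -> gtens X (gpow D l)}.

(** The left side of [rw_rel] for a family not yet known to be a coaction; being linear in [x], it
    can be shown to vanish on generators. *)
Definition coaction_defect n x : gtens X (gpow D n) :=
  \sum_(p < n.+1) \sum_(q < n.+1) \sum_(r < n.+1 | (p + q + r).+1 == n)
    (-1) ^+ (p.+1 * q.+1 + r) *:
      ktens 0 (lid X) (gcast D (p + (q.+1 + r)) n)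
        (ktens (adeg q) (lid X) (gins p r (adeg q) (aw D q))
          (rho (p + r).+1 x))
  + \sum_(b < n.+1) \sum_(c < n.+1 | (b + c == n)%N)
    (-1) ^+ c *:
      ktens 0 (lid X) (lcomp (gcast D (b + c) n) (gcat D b c))
        (gassoc X (gpow D b) (gpow D c)
          (ktens 0 (rho b) (lid (gpow D c)) (rho c x))).

Lemma coaction_defect_linear n : linear (coaction_defect n).
Proof.
apply: linear_fct_add.
  apply: linear_fct_sum => p; apply: linear_fct_sum => q.
  apply: linear_fct_sum => r.
  exact: (linear_fct_scale _ (lcomp (ktens 0 _ _)
    (lcomp (ktens _ _ _) (rho _)))).
apply: linear_fct_sum => b; apply: linear_fct_sum => c.
exact: (linear_fct_scale _ (lcomp (ktens 0 _ _)
  (lcomp (gassoc _ _ _) (lcomp (ktens 0 _ _) (rho c))))).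
Qed.

(** Each term of the relation is natural in [f] once the signs are gone, so the defect at [f x] is
    the image under [f] of the relation of [s] at [x]. *)
Lemma coaction_defect_coacts (N : gvect K) (s : rcomod_on D N)
    (f : {linear N -> X}) n x :
  acoalg_even D -> coacts s rho f -> coaction_defect n (f x) = 0.
Proof.
move=> D_even fs; rewrite -(linear0 (ktens 0 f (lid (gpow D n)))).
rewrite -[in RHS](rw_rel s n x) linearD /coaction_defect.
congr (_ + _).
  rewrite linear_sum; apply: eq_bigr => p _.
  rewrite linear_sum; apply: eq_bigr => q _.
  rewrite linear_sum; apply: eq_bigr => r _.
  rewrite [RHS]linearZ_LR; congr (_ *: _).
  by rewrite fs !gins_adeg // !ktens_swap.
rewrite linear_sum; apply: eq_bigr => b _.
rewrite linear_sum; apply: eq_bigr => c _.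
rewrite [RHS]linearZ_LR; congr (_ *: _).
rewrite fs -ktens_swap; congr (ktens 0 _ _ _).
rewrite -gassoc_natural -!ktens_comp; congr (gassoc _ _ _ _).
by apply: ktens_ext => // y; rewrite !lcompE fs.
Qed.

End CoactionDefect.

(** * Exchange of the left and right coactions *)

Section Bimodule.
Variables (K : fieldType) (C D : acoalg K) (N : cdspace C D).
Hypotheses (N_comm : cd_commuting N) (N_even : cd_even N).

(** The commuting condition with its sign removed and the reassociation moved to the other side,
    ready for rewriting. *)
Lemma commuting_assocV k l (x : N) :
  gassocV (gpow C k) N (gpow D l)
    (ktens 0 (lid (gpow C k)) (rw (cdr N) l) (lw (cdl N) k x)) =
  ktens 0 (lw (cdl N) k) (lid (gpow D l)) (rw (cdr N) l x).
Proof.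
rewrite -(rw_adeg _ _ N_even.2) -N_comm.
exact: tassocK.
Qed.

(* X and Y differ when this is applied to M ⊠ N: rho is then the map from
   M ⊗ N that is to be factored through the quotient. *)
Lemma coacts_lw (X Y : gvect K) k l (rho : {linear X -> gtens Y (gpow D l)})
    (G : {linear gtens (gpow C k) N -> X})
    (H : {linear gtens (gpow C k) N -> Y}) :
  (forall c n, rho (G (gpure c n)) =
    ktens 0 (lcomp H (gpurer N c)) (lid (gpow D l)) (rw (cdr N) l n)) ->
  forall x, rho (G (lw (cdl N) k x)) =
    ktens 0 (lcomp H (lw (cdl N) k)) (lid (gpow D l)) (rw (cdr N) l x).
Proof.
move=> rhoG x; rewrite (ktens_comp _ _ (lid _)) -commuting_assocV.
move: (lw _ k x) => z.
rewrite -[LHS]/(lcomp rho G z).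
rewrite -[RHS]/(lcomp (ktens 0 H (lid _)) (lcomp (gassocV _ _ _)
  (ktens 0 (lid _) (rw (cdr N) l))) z).
move: z; apply: tens_pure_ext => c n; rewrite !lcompE rhoG ktens0E.
by rewrite gassocV_pure (ktens_comp _ _ (lid _)).
Qed.

End Bimodule.

(** * The comodule [M ⊠ N] *)

Section Contratensor.
Variables (K : fieldType) (C D : acoalg K) (N : cdspace C D).
Hypotheses (N_comm : cd_commuting N) (N_even : cd_even N).
Hypothesis (D_even : acoalg_even D).

Lemma boxt_ev_pure (M : contramod C) k (f : ghom (gpow C k) M) (n : N) :
  boxt_ev M N k (gpure f n) = ktens 0 (ghom_ap f) (lid N) (lw (cdl N) k n).
Proof.
rewrite /boxt_ev !lcompE (lw_adeg _ _ N_even.1) ktens0E gassocV_pure.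
rewrite -ktens_comp; apply: ktens_ext => // c.
by rewrite lcompE gevE.
Qed.

Lemma boxt_act_pure (M : contramod C) k (f : ghom (gpow C k) M) (n : N) :
  boxt_act M N k (gpure f n) = gpure (cct M k f) n.
Proof. exact: ktens0E. Qed.

Section Lift.
Variables (M : contramod C) (U : lmodType K) (g : {linear gtens M N -> U}).
Hypothesis g_eq : forall k (f : ghom (gpow C k) M) (n : N),
  g (ktens 0 (ghom_ap f) (lid N) (lw (cdl N) k n)) = g (gpure (cct M k f) n).

Lemma boxt_lift_subproof z : boxt_smod M N z -> g z = 0.
Proof.
move=> [m [y ->]]; rewrite linear_sum big1 // => k _.
rewrite linearB; apply/eqP; rewrite subr_eq0; apply/eqP.
rewrite -[LHS]/(lcomp g (boxt_ev M N k) (y k)).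
rewrite -[RHS]/(lcomp g (boxt_act M N k) (y k)).
move: (y k); apply: tens_pure_ext => f n.
by rewrite [LHS]lcompE [RHS]lcompE boxt_ev_pure boxt_act_pure.
Qed.

Definition boxt_lift : {linear boxt M N -> U} :=
  lquot_map boxt_lift_subproof.

Lemma boxt_liftE z : boxt_lift (boxt_pi M N z) = g z.
Proof. exact: lquot_mapE. Qed.

End Lift.

Lemma boxt_lift_deg (M : contramod C) (U : gvect K) d
    (g : {linear gtens M N -> U})
    (g_eq : forall k (f : ghom (gpow C k) M) (n : N),
      g (ktens 0 (ghom_ap f) (lid N) (lw (cdl N) k n)) =
      g (gpure (cct M k f) n)) :
  gmap_deg d g -> gmap_deg d (boxt_lift g_eq : {linear boxt M N -> U}).
Proof.
move=> gd; apply: gquotv_map_deg => i z zi; rewrite lcompE.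
have -> : boxt_lift g_eq (boxt_pi M N z) = g z by apply: boxt_liftE.
exact: gd.
Qed.

Lemma boxt_ext (M : contramod C) (U : lmodType K)
    (f g : {linear boxt M N -> U}) :
  (forall m n, f (boxt_pi M N (gpure m n)) = g (boxt_pi M N (gpure m n))) ->
  f =1 g.
Proof.
move=> fg z; have [y ->] := lpi_surj z.
rewrite -[LHS]/(lcomp f (boxt_pi M N) y) -[RHS]/(lcomp g (boxt_pi M N) y).
by move: y; apply: tens_pure_ext.
Qed.

Definition boxt_pure (M : contramod C) (m : M) : {linear N -> boxt M N} :=
  lcomp (boxt_pi M N) (gpurer N m).

(** The defining relation of the coequalizer, in the form that trades [t_k] for [w^L]. *)
Lemma boxt_pure_ct (M : contramod C) k (f : ghom (gpow C k) M) (n : N) :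
  boxt_pure (cct M k f) n =
  boxt_pi M N (ktens 0 (ghom_ap f) (lid N) (lw (cdl N) k n)).
Proof.
apply: lquot_eq; rewrite -[gpurer N _ n]/(gpure (cct M k f) n).
rewrite -boxt_act_pure -boxt_ev_pure.
rewrite -opprB; apply: (smemN (S := boxt_smod M N)).
(* The family is [f ⊗ n] at index [k] and 0 elsewhere; its type depends on the index, so the value
   is transported along [j = k]. *)
pose y j : gtens (ghom (gpow C j) M) N :=
  if eqVneq j k is EqNotNeq e
  then ecast j (gtens (ghom (gpow C j) M) N) (esym e) (gpure f n) else 0.
have yk : y k = gpure f n.
  by rewrite /y; case: eqVneq => [e|/eqP//]; rewrite (eq_axiomK e).
(* The bound [k.+1] makes [k] the last index; all earlier terms are zero. *)
exists k.+1, y; rewrite big_ord_recr -[val ord_max]/k yk -[LHS]add0r.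
congr (_ + _); apply/esym/big1.
move=> j _; have jk : widen_ord (leqnSn k) j <> k :> nat.
  by apply/eqP; rewrite neq_ltn (ltn_ord j).
rewrite /y; case: eqVneq => // _.
by rewrite (linear0 (boxt_ev M N _)) (linear0 (boxt_act M N _)) subr0.
Qed.

Definition boxt_rw0 (M : contramod C) l :
    {linear gtens M N -> gtens (boxt M N) (gpow D l)} :=
  lcomp (ktens 0 (boxt_pi M N) (lid (gpow D l)))
    (lcomp (gassocV M N (gpow D l)) (ktens (adeg l) (lid M) (rw (cdr N) l))).

Lemma boxt_rw0_pure (M : contramod C) l (m : M) (n : N) :
  boxt_rw0 M l (gpure m n) =
  ktens 0 (boxt_pure m) (lid (gpow D l)) (rw (cdr N) l n).
Proof.
rewrite /boxt_rw0 !lcompE (rw_adeg _ _ N_even.2) ktens0E gassocV_pure.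
by rewrite -ktens_comp.
Qed.

(** Here the commutation of [w^L] and [w^R] enters: it moves the coaction past [w^L], after which
    [boxt_pure_ct] identifies the two sides. *)
Lemma boxt_rw_subproof (M : contramod C) l k (f : ghom (gpow C k) M) (n : N) :
  boxt_rw0 M l (ktens 0 (ghom_ap f) (lid N) (lw (cdl N) k n)) =
  boxt_rw0 M l (gpure (cct M k f) n).
Proof.
rewrite boxt_rw0_pure.
rewrite (coacts_lw N_comm N_even
  (H := lcomp (boxt_pi M N) (ktens 0 (ghom_ap f) (lid N)))).
  by apply: ktens_ext => // x; rewrite boxt_pure_ct.
move=> c x; rewrite ktens0E boxt_rw0_pure; apply: ktens_ext => // y.
by rewrite !lcompE [ktens _ _ _ _]ktens0E.
Qed.

Definition boxt_rw (M : contramod C) l :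
    {linear boxt M N -> gtens (boxt M N) (gpow D l)} :=
  boxt_lift (@boxt_rw_subproof M l).

Lemma boxt_rw_pure (M : contramod C) (m : M) :
  coacts (cdr N) (boxt_rw M) (boxt_pure m).
Proof. by move=> l n; rewrite [LHS]boxt_liftE boxt_rw0_pure. Qed.

Lemma boxt_rw_deg (M : contramod C) l : gmap_deg (adeg l) (boxt_rw M l).
Proof.
apply: boxt_lift_deg.
have h := lcomp_deg
  (ktens_deg (@gpi_deg _ _ (GSMod (@boxt_rel_stable _ _ _ M N)))
    (@lid_deg K (gpow D l)))
  (lcomp_deg (@gassocV_deg K M N (gpow D l))
    (ktens_deg (@lid_deg K M) (@rw_deg _ _ _ (cdr N) l))).
by move: h; rewrite !addr0 add0r.
Qed.

(** The images of the maps [boxt_pure m] span [M ⊠ N], and these maps respect the coactions, so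
    every relation is inherited from [w^R]. *)
Lemma boxt_rw_rel (M : contramod C) n (x : boxt M N) :
  coaction_defect (boxt_rw M) n x = 0.
Proof.
rewrite -[LHS]/(mklin (coaction_defect_linear (boxt_rw M) n) x).
rewrite -[RHS]/((\0 : {linear _ -> _}) x); move: x; apply: boxt_ext => m x.
exact: (coaction_defect_coacts _ _ D_even (@boxt_rw_pure M m)).
Qed.

Definition boxt_rcomod (M : contramod C) : rcomod_on D (boxt M N) :=
  RComodOn (@boxt_rw_deg M) (@boxt_rw_rel M).

Lemma boxt_rcomod_induced (M : contramod C) : boxt_induced (boxt_rcomod M).
Proof. by move=> l z; rewrite [LHS]boxt_liftE. Qed.

End Contratensor.

(** * Degrees and components in internal homs *)

Section GHomDegrees.
Variable K : fieldType.

Lemma hpost_deg (V W W' : gvect K) d (t : {linear W -> W'})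
    (td : gmap_deg d t) : gmap_deg d (hpost (V := V) td).
Proof.
move=> i f /ghom_degP fi; apply/ghom_degP => j x xj.
by rewrite hpostE addrA; apply/td/fi.
Qed.

Lemma hpre_deg (V' V W : gvect K) d (g : {linear V' -> V})
    (gd : gmap_deg d g) : gmap_deg d (hpre (W := W) gd).
Proof.
move=> i f fi; apply/ghom_degP => j x xj; rewrite hpreE (ksignE _ fi).
have /ghom_degP h := gdegZ ((-1) ^ (d * i)) fi.
by rewrite [i + d]addrC addrA; apply/h/gd.
Qed.

Lemma huncurry_deg (A B W : gvect K) :
  gmap_deg 0 (huncurry : {linear ghom A (ghom B W) -> ghom (gtens A B) W}).
Proof.
move=> i f /ghom_degP fi; apply/ghom_degP; rewrite addr0.
apply: gtens_map_deg => j l x y xj yl; rewrite huncurryE addrAC addrC.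
by have /ghom_degP := fi _ _ xj; apply.
Qed.

(** Lets compatibility with coactions pass to the homogeneous components of a map: the factor in [Z]
    keeps its degree, so selecting a degree of the value selects a degree of [f]. *)
Lemma ktens_ghom_proj (V W Z : gvect K) (f : ghom V W) j p (z : gtens V Z) :
  gdeg j z ->
  gproj _ (j + p) (ktens 0 (ghom_ap f) (lid Z) z) =
  ktens 0 (ghom_ap (gproj (ghom V W) p f)) (lid Z) z.
Proof.
(* Replacing [z] by its component of degree [j] makes both sides linear in an arbitrary [z]. *)
move=> <-.
rewrite -[LHS]/(lcomp (gproj _ (j + p))
  (lcomp (ktens 0 (ghom_ap f) (lid Z)) (gproj _ j)) z).
rewrite -[RHS]/(lcomp (ktens 0 (ghom_ap (gproj (ghom V W) p f)) (lid Z))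
  (gproj _ j) z).
move: z; apply: gtens_ext => a b v w va wb; rewrite !lcompE.
rewrite (gproj_deg _ (gpure_deg va wb)).
case: eqP => [->|_]; last by rewrite !linear0.
rewrite !ktens0E.
have wd : gmap_deg b (gpurel W w) by move=> i y yi; apply: gpure_deg.
rewrite -[X in gproj _ _ X]/(gpurel W w (ghom_ap f v)) (gmap_proj _ _ wd).
rewrite -[RHS]/(gpurel W w _); congr (gpurel W w _).
rewrite -[RHS]/(ghom_component p (ghom_ap f) v) /ghom_component (glueE _ va).
by rewrite lcompE addrAC addrK.
Qed.

Lemma ghom_ap_ksign_adeg (V W : gvect K) k (f : ghom V W) x :
  odd k -> ghom_ap (ksign (ghom V W) (adeg k) f) x = ghom_ap f x.
Proof. by move=> k_odd; rewrite ksign_adeg. Qed.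

End GHomDegrees.

(** * The space [[P, Q]^D] *)

Section RHom.
Variables (K : fieldType) (D : acoalg K) (P Q : rcomod D).
Hypothesis P_even : rcomod_even (rcomod_str P).
Let coactsPQ := coacts (rcomod_str P) (rcw Q).

(** For odd [k] the exponent [p * adeg k] is even, and for even [k] the coaction of [P] is zero;
    compatibility therefore does not depend on [p]. *)
Lemma rcompat_even p (f : {linear P -> Q}) : rcompat p f <-> coactsPQ f.
Proof.
have sgnE k x : (-1) ^ (p * adeg k) *: ktens 0 f (lid (gpow D k)) (rcw P k x)
    = ktens 0 f (lid (gpow D k)) (rcw P k x).
  have [k_odd|/P_even->] := boolP (odd k); last by rewrite linear0 scaler0.
  by rewrite mulrC sign_adeg ?scale1r.
by split=> h k x; move: (h k x); rewrite sgnE.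
Qed.

Lemma rhom_coacts (f : rhom P Q) : coactsPQ (ghom_ap (rhom_incl P Q f)).
Proof.
have fP : rhom_spec (rhom_incl P Q f) := lvalS (f : lsub _).
move=> k x; rewrite (gsupp_sum (rhom_incl P Q f)).
have g_lin : linear (fun h : ghom P Q => rcw Q k (ghom_ap h x)).
  by move=> a u v; rewrite ghom_ap_lin linearP.
have g'_lin : linear
    (fun h : ghom P Q => ktens 0 (ghom_ap h) (lid (gpow D k)) (rcw P k x)).
  by move=> a u v; apply: ktens0_linl => y; apply: ghom_ap_lin.
rewrite -[LHS]/(mklin g_lin _) -[RHS]/(mklin g'_lin _) !linear_sum.
by apply: eq_bigr => p _; have /rcompat_even := fP p; apply.
Qed.

(** Comparing terms of equal degree in the identity for [f] on homogeneous elements gives the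
    identity for each component. *)
Lemma coacts_rhom (f : ghom P Q) : coactsPQ (ghom_ap f) -> rhom_spec f.
Proof.
move=> fP p; apply/rcompat_even => k x.
rewrite -[LHS]/(lcomp (rcw Q k) (ghom_ap (gproj (ghom P Q) p f)) x).
rewrite -[RHS]/(lcomp (ktens 0 (ghom_ap (gproj (ghom P Q) p f)) (lid _))
  (rcw P k) x).
move: x; apply: glin_ext => i x xi; rewrite !lcompE.
have kx := @rw_deg _ _ _ (rcomod_str P) k i x xi.
rewrite -(ktens_ghom_proj _ _ kx) -fP.
rewrite (gmap_proj _ _ (@rw_deg _ _ _ (rcomod_str Q) k)).
rewrite -[ghom_ap _ x]/(ghom_component p (ghom_ap f) x).
rewrite /ghom_component (glueE _ xi) lcompE; congr (rcw Q k (gproj _ _ _)).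
by rewrite addrAC addrK.
Qed.

Lemma rhom_ext (f g : rhom P Q) :
  ghom_ap (rhom_incl P Q f) =1 ghom_ap (rhom_incl P Q g) -> f = g.
Proof. by move=> fg; apply/val_inj/ghom_ext. Qed.

Lemma rhom_degP p (f : rhom P Q) : gdeg p (rhom_incl P Q f) -> gdeg p f.
Proof. by move=> fp; apply/val_inj. Qed.

Section Lift.
Variables (U : lmodType K) (g : {linear U -> ghom P Q}).
Hypothesis g_coacts : forall u, coactsPQ (ghom_ap (g u)).

Definition rhom_lift_fun u : rhom P Q :=
  mklsub (S := rhom_smod P Q) (coacts_rhom (g_coacts u)).

Lemma rhom_lift_linear : linear rhom_lift_fun.
Proof. by move=> a x y; apply: val_inj; apply: (linearP g). Qed.

Definition rhom_lift : {linear U -> rhom P Q} := mklin rhom_lift_linear.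

End Lift.

Lemma rhom_lift_deg (U : gvect K) d (g : {linear U -> ghom P Q})
    (g_coacts : forall u, coactsPQ (ghom_ap (g u))) :
  gmap_deg d g -> gmap_deg d (rhom_lift g_coacts : {linear U -> rhom P Q}).
Proof. by move=> gd i u ui; apply: rhom_degP; apply: gd. Qed.

End RHom.

(** * The contramodule [[N, Q]^D] *)

Section RHomContra.
Variables (K : fieldType) (C D : acoalg K) (N : cdspace C D) (Q : rcomod D).
Hypotheses (N_comm : cd_commuting N) (N_even : cd_even N).
Hypothesis C_even : acoalg_even C.

Let NQ := rhom (cd_rcomod N) Q.
Let incl : {linear NQ -> ghom N Q} := rhom_incl (cd_rcomod N) Q.

Definition rhom_uncurry (A : gvect K) (f : ghom A NQ) :
    {linear gtens A N -> Q} :=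
  ghom_ap (huncurry (hpost (@rhom_incl_deg _ _ (cd_rcomod N) Q) f)).

Lemma rhom_uncurryE (A : gvect K) (f : ghom A NQ) a n :
  rhom_uncurry f (gpure a n) = ghom_ap (incl (ghom_ap f a)) n.
Proof. exact: huncurryE. Qed.

(** Valued in the full internal hom, since membership in [[N, Q]^D] has to be proved first. *)
Definition rhom_act k : {linear ghom (gpow C k) NQ -> ghom N Q} :=
  lcomp (hpre (@lw_deg _ _ _ (cdl N) k))
    (lcomp huncurry (hpost (@rhom_incl_deg _ _ (cd_rcomod N) Q))).

Lemma rhom_actE k (f : ghom (gpow C k) NQ) x :
  ghom_ap (rhom_act k f) x = rhom_uncurry f (lw (cdl N) k x).
Proof.
rewrite [LHS]hpreE; have [k_odd|/N_even.1->] := boolP (odd k).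
  exact: ghom_ap_ksign_adeg.
by rewrite !linear0.
Qed.

(** Commutation of [w^L] and [w^R] reduces this to the maps [n |-> f c n], which lie in
    [[N, Q]^D]. *)
Lemma rhom_act_coacts k (f : ghom (gpow C k) NQ) :
  coacts (cdr N) (rcw Q) (ghom_ap (rhom_act k f)).
Proof.
move=> l x; rewrite rhom_actE.
rewrite (coacts_lw N_comm N_even (H := rhom_uncurry f)).
  by apply: ktens_ext => // y; rewrite rhom_actE.
move=> c n; rewrite rhom_uncurryE (rhom_coacts (P := cd_rcomod N) N_even.2).
by apply: ktens_ext => // y; rewrite lcompE [RHS]rhom_uncurryE.
Qed.

Definition rhom_ct k : {linear ghom (gpow C k) NQ -> NQ} :=
  rhom_lift (P := cd_rcomod N) N_even.2 (@rhom_act_coacts k).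

Lemma rhom_ctE k (f : ghom (gpow C k) NQ) x :
  ghom_ap (incl (rhom_ct k f)) x = rhom_uncurry f (lw (cdl N) k x).
Proof. exact: rhom_actE. Qed.

Lemma rhom_ct_deg k : gmap_deg (adeg k) (rhom_ct k).
Proof.
apply: rhom_lift_deg.
have h := lcomp_deg (hpre_deg (W := Q) (@lw_deg _ _ _ (cdl N) k))
  (lcomp_deg (@huncurry_deg K (gpow C k) N Q)
    (hpost_deg (V := gpow C k) (@rhom_incl_deg _ _ (cd_rcomod N) Q))).
by move: h; rewrite !add0r.
Qed.

(** The hypothesis concerns only the image of [g], which covers both an even degree [d] and a zero
    map [g]. *)
Lemma rhom_uncurry_hpre (A B : gvect K) d (g : {linear A -> B})
    (gd : gmap_deg d g) (f : ghom B NQ) z :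
  (forall a, ghom_ap (ksign _ d f) (g a) = ghom_ap f (g a)) ->
  rhom_uncurry (hpre gd f) z = rhom_uncurry f (ktens 0 g (lid N) z).
Proof.
move=> fg; rewrite -[RHS]/(lcomp (rhom_uncurry f) (ktens 0 g (lid N)) z).
move: z; apply: tens_pure_ext => a n.
by rewrite lcompE ktens0E !rhom_uncurryE hpreE fg.
Qed.

Lemma rhom_uncurry_hpre0 (A B : gvect K) (g : {linear A -> B})
    (gd : gmap_deg 0 g) (f : ghom B NQ) z :
  rhom_uncurry (hpre gd f) z = rhom_uncurry f (ktens 0 g (lid N) z).
Proof.
(* [adeg 1] computes to 0, so the lemma on odd indices covers degree 0. *)
apply: rhom_uncurry_hpre => a; exact: (@ghom_ap_ksign_adeg _ _ _ 1).
Qed.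

Lemma rhom_uncurry_gins n p q r (f : ghom (gpow C n) NQ) z :
  rhom_uncurry (hpre (gins_deg (p := p) (r := r) (@aw'_deg K C q))
    (hpre (@gcast_deg K C (p + (q.+1 + r)) n) f)) z =
  rhom_uncurry f (ktens 0 (gcast C (p + (q.+1 + r)) n) (lid N)
    (ktens 0 (gins p r (adeg q) (aw C q)) (lid N) z)).
Proof.
rewrite rhom_uncurry_hpre; last first.
  move=> a; have [q_odd|/C_even wq] := boolP (odd q).
    exact: ghom_ap_ksign_adeg.
  by rewrite gins_eq0 ?linear0 // => x; rewrite aw'_even.
rewrite rhom_uncurry_hpre0; congr (rhom_uncurry _ (ktens _ _ _ _)).
by apply: ktens_ext => //; apply: gins_ext => x; apply: aw'_even.
Qed.

(** On a pure tensor [c ⊗ x] the inner action evaluates at [w^L x], and currying along [gcat] joins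
    [c] with the new factors of [C]; this is the iterated coaction. *)
Lemma rhom_uncurry_curry n a b (f : ghom (gpow C n) NQ) z :
  rhom_uncurry (hpost (@rhom_ct_deg b) (hcurry (hpre (@gcat_deg K C a b)
    (hpre (@gcast_deg K C (a + b) n) f)))) z =
  rhom_uncurry f (ktens 0 (lcomp (gcast C (a + b) n) (gcat C a b)) (lid N)
    (gassocV (gpow C a) (gpow C b) N
      (ktens (adeg b) (lid (gpow C a)) (lw (cdl N) b) z))).
Proof.
rewrite (lw_adeg _ _ N_even.1).
rewrite -[RHS]/(lcomp (rhom_uncurry f) (lcomp (ktens 0 _ (lid N))
  (lcomp (gassocV _ _ N) (ktens 0 (lid _) (lw (cdl N) b)))) z).
move: z; apply: tens_pure_ext => c x.
rewrite rhom_uncurryE hpostE rhom_ctE.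
rewrite [RHS]lcompE [X in _ = _ X]lcompE.
rewrite [X in ktens _ _ _ X]lcompE ktens0E.
rewrite gassocV_pure.
rewrite -ktens_comp; move: (lw _ b x) => y.
rewrite -[RHS]/(lcomp (rhom_uncurry f) (ktens 0 _ (lid N)) y).
move: y; apply: tens_pure_ext => y n'.
rewrite lcompE ktens0E !rhom_uncurryE hcurryE !hpreE.
by rewrite (@ksign_adeg _ _ 1) // hpreE (@ksign_adeg _ _ 1).
Qed.

Lemma rhom_ct_rel n (f : ghom (gpow C n) NQ) :
    \sum_(p < n.+1) \sum_(q < n.+1) \sum_(r < n.+1 | (p + q + r).+1 == n)
      (-1) ^+ (p + q.+1 * r.+1) *:
        rhom_ct (p + r).+1 (hpre (gins_deg (p := p) (r := r) (@aw'_deg K C q))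
          (hpre (@gcast_deg K C (p + (q.+1 + r)) n) f))
    + \sum_(a < n.+1) \sum_(b < n.+1 | (a + b == n)%N)
      (-1) ^+ a *:
        rhom_ct a (hpost (@rhom_ct_deg b)
          (hcurry (hpre (@gcat_deg K C a b)
            (hpre (@gcast_deg K C (a + b) n) f)))) = 0.
Proof.
apply: rhom_ext => x.
have ev_lin : linear (fun h : NQ => ghom_ap (incl h) x).
  by move=> a u v; rewrite linearP ghom_ap_lin.
(* Wherever a term survives, its signs in the two relations turn out to be opposite, hence the
   minus. *)
have opp_lin : linear (fun z => - rhom_uncurry f z).
  by move=> a u v; rewrite linearP opprD scalerN.
have := congr1 (mklin opp_lin) (lw_rel (cdl N) n x).
rewrite linear0 linearD => h.
rewrite -[LHS]/(mklin ev_lin _) -[RHS]/(0 : Q) -[in RHS]h linearD.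
congr (_ + _).
  rewrite [LHS]linear_sum [RHS]linear_sum; apply: eq_bigr => p _.
  rewrite [LHS]linear_sum [RHS]linear_sum; apply: eq_bigr => q _.
  rewrite [LHS]linear_sum [RHS]linear_sum; apply: eq_bigr => r _.
  rewrite [LHS]linearZ_LR [RHS]linearZ_LR.
  rewrite -[mklin ev_lin _]/(ghom_ap (incl _) x) rhom_ctE rhom_uncurry_gins.
  rewrite -[mklin opp_lin _]/(- rhom_uncurry f _) scalerN -scaleNr.
  have [q_odd|/C_even wq] := boolP (odd q); last first.
    rewrite [X in ktens _ _ _ X]ktens_eq0l; last exact: gins_eq0.
    by rewrite !linear0.
  have [pr_odd|/(N_even.1 (p + r).+1) ->] := boolP (odd (p + r).+1); last first.
    by rewrite !linear0.
  (* Now [q] is odd and [p + r] is even: the signs are [(-1)^p] and [(-1)^(r + 1)], which are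
     opposite. *)
  congr (_ *: _); rewrite -signr_odd -[X in _ = - X]signr_odd.
  move: pr_odd; rewrite /= !oddD !oddM /= q_odd /= andbF addbF.
  by case: (odd p); case: (odd r) => //= _; rewrite ?expr0 ?expr1 ?opprK.
rewrite [LHS]linear_sum [RHS]linear_sum; apply: eq_bigr => a _.
rewrite [LHS]linear_sum [RHS]linear_sum; apply: eq_bigr => b _.
rewrite [LHS]linearZ_LR [RHS]linearZ_LR.
rewrite -[mklin ev_lin _]/(ghom_ap (incl _) x) rhom_ctE rhom_uncurry_curry.
rewrite -[mklin opp_lin _]/(- rhom_uncurry f _) scalerN -scaleNr.
have [b_odd|/N_even.1 wb] := boolP (odd b); last first.
  by rewrite [X in gassocV _ _ _ X]ktens_eq0r ?linear0.
have [a_odd|/(N_even.1 a) ->] := boolP (odd a); last by rewrite !linear0.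
(* With [a] and [b] odd the signs are [(-1)^a = -1] and [(-1)^(a * (b + 1)) = 1]. *)
congr (_ *: _); rewrite -signr_odd -[X in _ = - X]signr_odd.
by rewrite oddM /= a_odd b_odd /= expr0 expr1.
Qed.

Definition rhom_contramod : contramod_on C NQ :=
  ContraOn (@rhom_ct_rel).

End RHomContra.

(** * The functors [- ⊠ N] and [[N, -]^D] on morphisms *)

Lemma hcurry_deg (K : fieldType) (A B W : gvect K) :
  gmap_deg 0 (hcurry : {linear ghom (gtens A B) W -> ghom A (ghom B W)}).
Proof.
move=> i f /ghom_degP fi; rewrite addr0; apply/ghom_degP => j x xj.
apply/ghom_degP => l y yl; rewrite hcurryE addrCA addrA.
by apply: fi; apply: gpure_deg.
Qed.

Section Adjunction.
Variables (K : fieldType) (C D : acoalg K) (N : cdspace C D).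
Hypotheses (C_even : acoalg_even C) (D_even : acoalg_even D).
Hypotheses (N_comm : cd_commuting N) (N_even : cd_even N).

Let F (M : contramod C) : rcomod D :=
  RComod (boxt_rcomod N_comm N_even D_even M).
Let G (Q : rcomod D) : contramod C :=
  Contra (rhom_contramod Q N_comm N_even C_even).

Section FMap.
Variables (M M' : contramod C) (h : contramod_hom M M').

Definition boxt_map0 : {linear gtens M N -> boxt M' N} :=
  lcomp (boxt_pi M' N) (ktens 0 h (lid N)).

(** Since [h] commutes with [t_k], the relation for [f] in [M] is sent to the relation for [h \o f]
    in [M']. *)
Lemma boxt_map_subproof k (f : ghom (gpow C k) M) (n : N) :
  boxt_map0 (ktens 0 (ghom_ap f) (lid N) (lw (cdl N) k n)) =
  boxt_map0 (gpure (cct M k f) n).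
Proof.
rewrite [RHS]lcompE ktens0E ch_comp.
rewrite -[RHS]/(boxt_pure N (cct M' k (hpost (@ch_deg _ _ _ _ h) f)) n).
rewrite (boxt_pure_ct N_even) [LHS]lcompE -ktens_comp.
by congr (boxt_pi M' N _); apply: ktens_ext.
Qed.

Definition boxt_map : {linear F M -> F M'} :=
  boxt_lift N_even boxt_map_subproof.

Lemma boxt_mapE m n :
  boxt_map (boxt_pi M N (gpure m n)) = boxt_pi M' N (gpure (h m) n).
Proof. by rewrite [LHS]boxt_liftE /boxt_map0 lcompE ktens0E. Qed.

Lemma boxt_map_deg : gmap_deg 0 boxt_map.
Proof.
apply: boxt_lift_deg; apply: lcomp_deg0; first exact: gpi_deg.
have := ktens_deg (@ch_deg _ _ _ _ h) (@lid_deg K N).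
by rewrite addr0.
Qed.

Lemma boxt_map_comp k x :
  rcw (F M') k (boxt_map x) =
  ktens 0 boxt_map (lid (gpow D k)) (rcw (F M) k x).
Proof.
rewrite -[LHS]/(lcomp (rcw (F M') k) boxt_map x).
rewrite -[RHS]/(lcomp (ktens 0 boxt_map (lid (gpow D k))) (rcw (F M) k) x).
move: x; apply: boxt_ext => m n; rewrite !lcompE boxt_mapE.
rewrite [LHS](boxt_rw_pure N_comm N_even (h m)).
rewrite -[boxt_pi M N _]/(boxt_pure N m n).
rewrite [X in _ = ktens _ _ _ X](boxt_rw_pure N_comm N_even m) -ktens_comp.
by apply: ktens_ext => // y; rewrite lcompE [RHS]boxt_mapE.
Qed.

Definition boxt_hom : rcomod_hom (F M) (F M') :=
  RComodHom boxt_map_deg boxt_map_comp.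

End FMap.

Section GMap.
Variables (Q Q' : rcomod D) (g : rcomod_hom Q Q').

Lemma rhom_map_coacts (f : G Q) :
  coacts (cdr N) (rcw Q')
    (ghom_ap (hpost (@rh_deg _ _ _ _ g) (rhom_incl (cd_rcomod N) Q f))).
Proof.
move=> l x; rewrite hpostE rh_comp.
rewrite (rhom_coacts (P := cd_rcomod N) N_even.2) -ktens_comp.
exact: ktens_ext.
Qed.

Definition rhom_map : {linear G Q -> G Q'} :=
  rhom_lift (P := cd_rcomod N) N_even.2
    (g := lcomp (hpost (@rh_deg _ _ _ _ g)) (rhom_incl (cd_rcomod N) Q))
    rhom_map_coacts.

Lemma rhom_mapE f :
  rhom_incl (cd_rcomod N) Q' (rhom_map f) =
  hpost (@rh_deg _ _ _ _ g) (rhom_incl (cd_rcomod N) Q f).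
Proof. by []. Qed.

Lemma rhom_map_deg : gmap_deg 0 rhom_map.
Proof.
apply: rhom_lift_deg; apply: lcomp_deg0; first exact: hpost_deg.
exact: rhom_incl_deg.
Qed.

Lemma rhom_map_comp k (f : ghom (gpow C k) (G Q)) :
  rhom_map (cct (G Q) k f) = cct (G Q') k (hpost rhom_map_deg f).
Proof.
apply: rhom_ext => x; rewrite rhom_mapE hpostE [X in g X]rhom_ctE.
rewrite [RHS]rhom_ctE; move: (lw _ k x) => z.
rewrite -[LHS]/(lcomp g (rhom_uncurry f) z).
move: z; apply: tens_pure_ext => c n.
by rewrite lcompE [X in g X]rhom_uncurryE [RHS]rhom_uncurryE.
Qed.

Definition rhom_hom : contramod_hom (G Q) (G Q') := ContraHom rhom_map_comp.

End GMap.

(** * Transposition by currying *)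

Section Transpose.
Variables (M : contramod C) (Q : rcomod D).

Section Curry.
Variable g : rcomod_hom (F M) Q.

Definition curry0 : {linear M -> ghom N Q} :=
  ghom_ap (hcurry (mkghom (GHomDeg (lcomp_deg0 (@rh_deg _ _ _ _ g)
    (@gpi_deg _ _ (GSMod (@boxt_rel_stable _ _ _ M N))))))).

Lemma curry0E m n : ghom_ap (curry0 m) n = g (boxt_pi M N (gpure m n)).
Proof. by []. Qed.

Lemma curry0_coacts m : coacts (cdr N) (rcw Q) (ghom_ap (curry0 m)).
Proof.
move=> l n; rewrite curry0E rh_comp.
rewrite -[boxt_pi M N _]/(boxt_pure N m n).
rewrite [X in ktens _ _ _ X](boxt_rw_pure N_comm N_even m) -ktens_comp.
exact: ktens_ext.
Qed.

Definition curry_map : {linear M -> G Q} :=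
  rhom_lift (P := cd_rcomod N) N_even.2 curry0_coacts.

Lemma curry_mapE m n :
  ghom_ap (rhom_incl (cd_rcomod N) Q (curry_map m)) n =
  g (boxt_pi M N (gpure m n)).
Proof. by []. Qed.

Lemma curry_map_deg : gmap_deg 0 curry_map.
Proof.
apply: rhom_lift_deg; apply/ghom_degP; apply: (hcurry_deg (i := 0)).
by apply/ghom_degP; apply: lcomp_deg0; [exact: rh_deg|exact: gpi_deg].
Qed.

(** The transpose respects [t_k] because [g] is defined on the quotient, where [boxt_pure_ct]
    holds. *)
Lemma curry_map_comp k (f : ghom (gpow C k) M) :
  curry_map (cct M k f) = cct (G Q) k (hpost curry_map_deg f).
Proof.
apply: rhom_ext => n; rewrite curry_mapE [RHS]rhom_ctE.
rewrite -[boxt_pi M N _]/(boxt_pure N (cct M k f) n) (boxt_pure_ct N_even).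
move: (lw _ k n) => z.
rewrite -[LHS]/(lcomp g (lcomp (boxt_pi M N) (ktens 0 (ghom_ap f) (lid N))) z).
move: z; apply: tens_pure_ext => c x; rewrite !lcompE.
by rewrite [X in boxt_pi _ _ X]ktens0E [RHS]rhom_uncurryE.
Qed.

Definition curry_hom : contramod_hom M (G Q) := ContraHom curry_map_comp.

End Curry.

Section Uncurry.
Variable h : contramod_hom M (G Q).

Definition uncurry0 : {linear gtens M N -> Q} :=
  rhom_uncurry (mkghom (GHomDeg (@ch_deg _ _ _ _ h))).

Lemma uncurry0E m n :
  uncurry0 (gpure m n) = ghom_ap (rhom_incl (cd_rcomod N) Q (h m)) n.
Proof. exact: rhom_uncurryE. Qed.

(** The converse of [curry_map_comp]: compatibility of [h] with [t_k], evaluated at [n], is the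
    relation of the coequalizer. *)
Lemma uncurry_subproof k (f : ghom (gpow C k) M) (n : N) :
  uncurry0 (ktens 0 (ghom_ap f) (lid N) (lw (cdl N) k n)) =
  uncurry0 (gpure (cct M k f) n).
Proof.
rewrite uncurry0E ch_comp [RHS]rhom_ctE; move: (lw _ k n) => z.
rewrite -[LHS]/(lcomp uncurry0 (ktens 0 (ghom_ap f) (lid N)) z).
move: z; apply: tens_pure_ext => c x.
by rewrite lcompE ktens0E uncurry0E [RHS]rhom_uncurryE.
Qed.

Definition uncurry_map : {linear F M -> Q} :=
  boxt_lift N_even uncurry_subproof.

Lemma uncurry_mapE m n : uncurry_map (boxt_pi M N (gpure m n)) =
  ghom_ap (rhom_incl (cd_rcomod N) Q (h m)) n.
Proof. by rewrite [LHS]boxt_liftE uncurry0E. Qed.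

Lemma uncurry_map_deg : gmap_deg 0 uncurry_map.
Proof.
apply: boxt_lift_deg; apply/ghom_degP.
apply: (huncurry_deg (i := 0)); apply: (hpost_deg _ (i := 0)).
by apply/ghom_degP; exact: (@ch_deg _ _ _ _ h).
Qed.

Lemma uncurry_map_comp k x :
  rcw Q k (uncurry_map x) =
  ktens 0 uncurry_map (lid (gpow D k)) (rcw (F M) k x).
Proof.
rewrite -[LHS]/(lcomp (rcw Q k) uncurry_map x).
rewrite -[RHS]/(lcomp (ktens 0 uncurry_map (lid (gpow D k))) (rcw (F M) k) x).
move: x; apply: boxt_ext => m n; rewrite !lcompE uncurry_mapE.
rewrite (rhom_coacts (P := cd_rcomod N) N_even.2).
rewrite -[boxt_pi M N _]/(boxt_pure N m n).
rewrite [X in _ = ktens _ _ _ X](boxt_rw_pure N_comm N_even m) -ktens_comp.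
by apply: ktens_ext => // y; rewrite lcompE [RHS]uncurry_mapE.
Qed.

Definition uncurry_hom : rcomod_hom (F M) Q :=
  RComodHom uncurry_map_deg uncurry_map_comp.

End Uncurry.

(** Maps out of [F M] are determined on the classes of pure tensors and maps into [G Q] by their
    values on [N]; there both transposes are given by the same formula. *)
Lemma curry_hom_bijective : bijective curry_hom.
Proof.
exists uncurry_hom => [g|h].
  by apply: rcomod_hom_eq; apply: boxt_ext => m n; rewrite [LHS]uncurry_mapE.
apply: contramod_hom_eq => m; apply: rhom_ext => n.
by rewrite [LHS]curry_mapE [LHS]uncurry_mapE.
Qed.

End Transpose.

End Adjunction.

Theorem theorem9p8 (K : fieldType) (C D : acoalg K) (N : cdspace C D)
    (C_even : acoalg_even C) (D_even : acoalg_even D)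
    (N_comm : cd_commuting N) (N_even : cd_even N) :
  exists (sF : forall M : contramod C, rcomod_on D (boxt M N))
         (sG : forall Q : rcomod D, contramod_on C (rhom (cd_rcomod N) Q)),
    (forall M, boxt_induced (sF M)) /\
    (forall Q, rhom_induced (sG Q)) /\
    let F (M : contramod_cat C) : rcomod_cat D := RComod (sF M) in
    let G (Q : rcomod_cat D) : contramod_cat C := Contra (sG Q) in
    exists (F1 : forall M M' : contramod_cat C, mor M M' -> mor (F M) (F M'))
           (G1 : forall Q Q' : rcomod_cat D, mor Q Q' -> mor (G Q) (G Q')),
      [/\ is_functor F1,
          is_functor G1,
          (forall (M M' : contramod C) (h : contramod_hom M M') (m : M) (n : N),
            (F1 M M' h : rcomod_hom _ _) (boxt_pi M N (gpure m n)) =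
            boxt_pi M' N (gpure (h m) n)),
          (forall (Q Q' : rcomod D) (g : rcomod_hom Q Q')
              (f : rhom (cd_rcomod N) Q),
            rhom_incl (cd_rcomod N) Q' ((G1 Q Q' g : contramod_hom _ _) f) =
            hpost (@rh_deg _ _ _ _ g) (rhom_incl (cd_rcomod N) Q f)) &
          exists Phi : forall M Q, mor (F M) Q -> mor M (G Q),
            is_adjunction F1 G1 Phi].
Proof.
exists (boxt_rcomod N_comm N_even D_even).
exists (fun Q => rhom_contramod Q N_comm N_even C_even).
split; first exact: boxt_rcomod_induced.
split; first by move=> Q k f.
move=> F G; exists (boxt_hom D_even N_comm N_even).
exists (rhom_hom C_even N_comm N_even); split.
- split=> [M|M1 M2 M3 g f]; apply: rcomod_hom_eq; apply: boxt_ext => m n.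
    by rewrite [LHS]boxt_mapE.
  by rewrite [LHS]boxt_mapE [RHS]lcompE [X in _ = _ X]boxt_mapE [RHS]boxt_mapE.
- split=> [Q|Q1 Q2 Q3 g f]; apply: contramod_hom_eq => u;
    exact: rhom_ext.
- exact: boxt_mapE.
- exact: rhom_mapE.
exists (@curry_hom _ _ _ _ C_even D_even N_comm N_even); split.
  exact: curry_hom_bijective.
(* At [m] and [n] both sides are [g] applied to [f] of the class of [h m ⊗ n]. *)
move=> M M' Q Q' h g f; apply: contramod_hom_eq => m; apply: rhom_ext => n.
by rewrite [LHS]curry_mapE /= [X in f X]boxt_mapE.
Qed.
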